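(* The norm of the operator $\mathcal{B}: u \mapsto u - u(0)$ on the real harmonic Bergman space $a^1_{\mathbb{R}}$ is at most $1.835$. In fact, the same estimate $\|u - u(0)\|_{L^1} \le 1.835\,\|u\|_{L^1}$ for all $u \in X$ holds on any subspace $X$ of $L^1(\mathbb{D})$ having the following two properties: (i) every $u \in X$ satisfies $|u(re^{i\theta})| \le (1-r)^{-2}\|u\|_{L^1}$ for all $0 \le r<1$ and all $\theta$; (ii) for every $u \in X$, the average value $\frac{1}{2\pi}\int_0^{2\pi} u(re^{i\theta})\,d\theta$ of $u$ on circles centered at the origin is constant in $r \in [0,1)$ (so that it equals $u(0)$).
   Context: $\mathbb{D}$ is the open unit disc and $L^1 = L^1(\mathbb{D})$ is the space of integrable functions on $\mathbb{D}$ with respect to normalized area measure (total mass $1$), with its usual norm. $a^1_{\mathbb{R}}$ is the (real) subspace of $L^1(\mathbb{D})$ consisting of real-valued harmonic functions, with the $L^1$ norm. *)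

(* Defs.v *)
From mathcomp Require Import all_boot all_order all_algebra.
From mathcomp Require Import all_classical all_reals all_analysis.
From mathcomp Require Import complex.

Set Implicit Arguments.
Unset Strict Implicit.
Unset Printing Implicit Defensive.

Import Order.TTheory GRing.Theory Num.Theory.
Import numFieldNormedType.Exports.
Import ComplexField.Normc.

Local Open Scope classical_set_scope.
Local Open Scope ring_scope.

(* Points of the disc are pairs of reals, so that the product measure and the
   product normed module apply to them. Functions on the disc are encoded as
   total functions on the plane whose values off the disc are never used. *)

Definition unit_disc (R : realType) : set (R * R) :=
  [set p | p.1 ^+ 2 + p.2 ^+ 2 < 1].
Arguments unit_disc R _ : clear implicits.

(* r e^(i t) *)
Definition polar (R : realType) (r t : R) : R * R := (r * cos t, r * sin t).

Lemma inv_pi_ge0 (R : realType) : 0 <= (pi : R)^-1.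
Proof. by rewrite invr_ge0 pi_ge0. Qed.

(* Area measure normalized so that the unit disc has mass 1. *)
Definition area_measure (R : realType) :
    {measure set (measurableTypeR R * measurableTypeR R) -> \bar R} :=
  mscale (NngNum (inv_pi_ge0 R)) (@lebesgue_measure R \x @lebesgue_measure R)%E.

(* The norm is an extended real: it is the integral of a nonnegative function
   and needs no default value. *)
Definition L1norm (R : realType) (u : R * R -> R[i]) : \bar R :=
  (\int[area_measure R]_(p in unit_disc R) (normc (u p))%:E)%E.

Definition L1_disc (R : realType) : set (R * R -> R[i]) :=
  [set u | (area_measure R).-integrable (unit_disc R)
             (fun p => (complex.Re (u p))%:E) /\
           (area_measure R).-integrable (unit_disc R)
             (fun p => (complex.Im (u p))%:E)].
Arguments L1_disc R _ : clear implicits.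

(* Real linear, since the real-valued harmonic functions only form a real
   subspace; complex subspaces are in particular real ones. *)
Definition real_subspace (R : realType) (X : set (R * R -> R[i])) : Prop :=
  [/\ X (fun=> 0),
      forall u v, X u -> X v -> X (fun p => u p + v p) &
      forall (a : R) u, X u -> X (fun p => a%:C%C * u p)].

Definition dirx (R : realType) : R * R := (1, 0).
Definition diry (R : realType) : R * R := (0, 1).

Definition C2_disc (R : realType) (f : R * R -> R) : Prop :=
  forall p, unit_disc R p ->
  {for p, continuous f} /\
  forall v, v \in [:: dirx R; diry R] ->
  [/\ derivable f p v, {for p, continuous ('D_v f)} &
      forall w, w \in [:: dirx R; diry R] ->
      derivable ('D_v f) p w /\ {for p, continuous ('D_w ('D_v f))}].

Definition harmonic_disc (R : realType) (f : R * R -> R) : Prop :=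
  C2_disc f /\
  forall p, unit_disc R p ->
    'D_(dirx R) ('D_(dirx R) f) p + 'D_(diry R) ('D_(diry R) f) p = 0.

Definition a1R (R : realType) : set (R * R -> R[i]) :=
  [set u | [/\ L1_disc R u,
               forall p, unit_disc R p -> complex.Im (u p) = 0 &
               harmonic_disc (fun p => complex.Re (u p))]].
Arguments a1R R _ : clear implicits.

Definition circle_mean (R : realType) (u : R * R -> R[i]) (r : R) : R[i] :=
  ((2 * pi)^-1)%:C%C *
  (\int[lebesgue_measure]_(t in `[0, 2 * pi]) complex.Re (u (polar r t)) +i*
   \int[lebesgue_measure]_(t in `[0, 2 * pi]) complex.Im (u (polar r t)))%C.

Definition Bop (R : realType) (u : R * R -> R[i]) : R * R -> R[i] :=
  fun p => u p - u (0, 0).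

Definition opnorm (R : realType) (X : set (R * R -> R[i]))
    (T : (R * R -> R[i]) -> (R * R -> R[i])) : \bar R :=
  ereal_sup [set L1norm (T u) | u in [set u | X u /\ (L1norm u <= 1)%E]].

(* Main.v *)
(* Normalize ||u|| = 1 and write a = u(0), so that |a| <= 1. On |p| = r,
     |u| + |a| - |u - a| >= (|a||u| + Re(conj(a) u)) / (|u| + |a|)
                         >= 2 w(r) Re(conj(a) u),
   where w(r) = (1-r)^2 / (1 + (1-r)^2), because |u| <= (1-r)^-2. Replace w by a
   lower step function, a combination of indicators of discs centered at 0: its
   integral against Re(conj(a) u) only involves means of u over discs, which are
   all a. The gain is at least 0.165 |a|^2, and 1 + |a| - 0.165 |a|^2 <= 1.835.

   Polar coordinates are not needed. A disc mean is a mean of circle means since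
   rotations, being products of shears, preserve Lebesgue measure. For a harmonic
   f, f(p) - f(c) is the integral over s in [0, 1] of
   grad f(c + s(p - c)) . (p - c), and for fixed s its integral over the disc
   |p - c| < d is, by parts against (d^2 - |p - c|^2) / 2, an integral of the
   Laplacian of f. The means over discs that are not centered at 0 give
   |u(p)| <= (1 - |p|)^-2 ||u||. *)

Require Import Defs.
From HB Require Import structures.
From mathcomp Require Import all_boot all_order all_algebra.
From mathcomp Require Import all_classical all_reals all_analysis.
From mathcomp Require Import complex.
From mathcomp Require Import measurable_realfun ring lra.

Set Implicit Arguments.
Unset Strict Implicit.
Unset Printing Implicit Defensive.

Import Order.TTheory GRing.Theory Num.Theory.
Import numFieldNormedType.Exports.
Import ComplexField.Normc.

Local Open Scope classical_set_scope.
Local Open Scope ring_scope.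

(** * Integrals of bounded functions *)

(** The triangle inequality |u - a| <= |u| + |a| is nearly sharp only where u points away from a,
    but u has mean a over every disc centered at 0, so it cannot point away from a everywhere. To
    measure the loss through these means alone, the factor 1 / (|u| + |a|) has to be replaced by
    something radial, and this is what the growth bound allows. The resulting weight decreases in r,
    so its lower step functions are combinations of disc indicators with nonnegative coefficients.
    The full weight would give the gain 2 - pi + 2 ln 2, about 0.245; four discs already give more
    than 0.165.

    The harmonic case is not obtained as an instance of the second half of the theorem. Both halves
    reach the same estimate, whose input is the mean over discs centered at 0: circle means and
    rotations supply it for a general subspace, integration by parts supplies it for harmonic
    functions without passing through circles. *)

Lemma Rintegral_sum d (T : measurableType d) (R : realType)
    (mu : {measure set T -> \bar R}) (D : set T) (I : Type) (s : seq I)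
    (h : I -> T -> R) : measurable D ->
  (forall i, mu.-integrable D (EFin \o h i)) ->
  \int[mu]_(x in D) (\sum_(i <- s) h i x) = \sum_(i <- s) \int[mu]_(x in D) h i x.
Proof.
move=> mD ih; rewrite /Rintegral.
under eq_integral do rewrite -sumEFin.
rewrite integral_sum// -sum_fine// => i _.
exact: (integrable_fin_num mD (ih i)).
Qed.

Lemma integrable_Rsum d (T : measurableType d) (R : realType)
    (mu : {measure set T -> \bar R}) (D : set T) (I : Type) (s : seq I)
    (h : I -> T -> R) : measurable D ->
  (forall i, mu.-integrable D (EFin \o h i)) ->
  mu.-integrable D (fun x => (\sum_(i <- s) h i x)%:E).
Proof.
move=> mD ih.
apply: (@eq_integrable _ _ _ _ _ _ (fun x => (\sum_(i <- s) (h i x)%:E)%E)) => //.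
  by move=> x _; rewrite sumEFin.
by apply: integrable_sum => // i _; exact: ih.
Qed.

Section measure_preserving_integral.
Context d (T : measurableType d) (R : realType) (mu : {measure set T -> \bar R}).

Lemma bounded_integrable (A : set T) (f : T -> R) (M : R) : measurable A ->
  (mu A < +oo)%E -> measurable_fun A f -> (forall x, A x -> `|f x| <= M) ->
  mu.-integrable A (EFin \o f).
Proof.
move=> mA Afin mf fM; apply: measurable_bounded_integrable => //.
exists M; split; first exact: num_real.
by move=> N MN x Ax /=; rewrite (le_trans (fM _ Ax))// ltW.
Qed.

(** Extending [f] by 0 off [A] turns both sides into integrals over the whole space, where the
    change of variables is a pushforward and the pushforward of [mu] is [mu]. *)
Lemma Rintegral_preserving (phi : T -> T) (A : set T) (f : T -> R) (M : R) :
  measurable_fun setT phi ->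
  (forall B, measurable B -> mu (phi @^-1` B) = mu B) ->
  measurable A -> (mu A < +oo)%E -> measurable_fun A f ->
  (forall x, A x -> `|f x| <= M) ->
  \int[mu]_(x in phi @^-1` A) f (phi x) = \int[mu]_(x in A) f x.
Proof.
move=> mphi inv mA Afin mf fM.
have mpA : measurable (phi @^-1` A) by rewrite -[X in measurable X]setTI; exact: mphi.
have mfA : measurable_fun setT (f \_ A) by exact/(measurable_restrictT _ mA).
have E : (f \_ A) \o phi = (f \o phi) \_ (phi @^-1` A).
  by apply/funext => x; rewrite /= !patchE.
have ip : mu.-integrable setT ((EFin \o (f \_ A)) \o phi).
  rewrite -compA E -restrict_EFin; apply/(integrable_mkcond _ mpA).
  apply: (@bounded_integrable _ _ M) => //.
  - by rewrite inv.
  - by apply: (measurable_comp mA _ mf) => //; [move=> _ [x xA <-]|exact: measurable_funTS].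
  - by move=> x; exact: fM.
rewrite /Rintegral [in RHS]integral_mkcond [in LHS]integral_mkcond.
congr fine.
transitivity (\int[mu]_(x in phi @^-1` setT) ((EFin \o (f \_ A)) \o phi) x)%E.
  by rewrite preimage_setT -compA E -restrict_EFin.
rewrite -(integral_pushforward mphi _ ip)//; last exact/measurable_EFinP.
rewrite -restrict_EFin; apply: eq_measure_integral => B mB _; exact: inv.
Qed.
End measure_preserving_integral.

Section bounded_fubini.
Context d1 d2 (T1 : measurableType d1) (T2 : measurableType d2) (R : realType).
Variables (mu1 : {sigma_finite_measure set T1 -> \bar R}).
Variables (mu2 : {sigma_finite_measure set T2 -> \bar R}).
Variables (A : set T1) (B : set T2) (E : set (T1 * T2)).
Variables (f : T1 * T2 -> R) (M : R).
Hypotheses (mA : measurable A) (mB : measurable B) (mE : measurable E).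
Hypotheses (Afin : (mu1 A < +oo)%E) (Bfin : (mu2 B < +oo)%E).
Hypotheses (EAB : E `<=` A `*` B) (mf : measurable_fun E f).
Hypothesis fM : forall z, E z -> `|f z| <= M.

Let mfE : measurable_fun setT (f \_ E).
Proof. exact/(measurable_restrictT _ mE). Qed.

Let Efin : ((mu1 \x mu2)%E E < +oo)%E.
Proof.
apply: (@le_lt_trans _ _ ((mu1 \x mu2)%E (A `*` B))).
  by apply: le_measure => //; rewrite inE//; exact: measurableX.
by rewrite product_measure1E// lte_mul_pinfty// ge0_fin_numE.
Qed.

Let fi : (mu1 \x mu2)%E.-integrable setT (EFin \o (f \_ E)).
Proof.
rewrite -restrict_EFin; apply/(integrable_mkcond _ mE).
exact: (bounded_integrable mE Efin mf fM).
Qed.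

Let restrictE : (fun z => (f z)%:E) \_ E = EFin \o (f \_ E).
Proof. by apply/funext => z; rewrite /= !patchE; case: ifPn. Qed.

(** [E] is kept apart from the rectangle around it because it will be a disc, whose sections are
    intervals of varying length. The rectangle bounds the outer variable and makes all the measures
    finite. *)
Lemma Rintegral_prod12 : \int[(mu1 \x mu2)%E]_(z in E) f z =
  \int[mu1]_(x in A) \int[mu2]_(y in xsection E x) f (x, y).
Proof.
rewrite {1}/Rintegral integral_mkcond restrictE.
rewrite -(integral12_prod_meas1 fi) {1}/Rintegral [in RHS]integral_mkcond.
congr fine; apply: eq_integral => x _; rewrite patchE /fubini_F.
have mx : measurable (xsection E x) by exact: measurable_xsection.
have -> : (fun y => (EFin \o f \_ E) (x, y)) =
    (fun y => (f (x, y))%:E) \_ (xsection E x).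
  by apply/funext => y; rewrite /= !patchE mem_xsection; case: ifPn.
rewrite -integral_mkcond; case: ifPn => xA.
  rewrite /= /Rintegral fineK//; apply: integrable_fin_num => //.
  apply: (@bounded_integrable _ _ _ _ _ _ M) => //.
  - apply: le_lt_trans Bfin; apply: le_measure; rewrite ?inE//.
    by move=> y; rewrite /xsection/= inE => /EAB[].
  - apply: (measurable_restrictT (fun y => f (x, y)) mx).2.
    rewrite (_ : _ \_ _ = fun y => (f \_ E) (x, y)); first exact: measurable_fun_pair2.
    by apply/funext => y; rewrite !patchE mem_xsection.
  - by move=> y; rewrite /xsection/= inE => /fM.
rewrite (_ : xsection E x = set0) ?integral_set0//.
apply/seteqP; split => // y; rewrite /xsection/= inE => /EAB[/= Ax _].
by move: xA; rewrite notin_setE.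
Qed.

Lemma Rintegral_prod21 : \int[(mu1 \x mu2)%E]_(z in E) f z =
  \int[mu2]_(y in B) \int[mu1]_(x in ysection E y) f (x, y).
Proof.
rewrite {1}/Rintegral integral_mkcond restrictE.
rewrite -(integral21_prod_meas1 fi) {1}/Rintegral [in RHS]integral_mkcond.
congr fine; apply: eq_integral => y _; rewrite patchE /fubini_G.
have my : measurable (ysection E y) by exact: measurable_ysection.
have -> : (fun x => (EFin \o f \_ E) (x, y)) =
    (fun x => (f (x, y))%:E) \_ (ysection E y).
  by apply/funext => x; rewrite /= !patchE mem_ysection; case: ifPn.
rewrite -integral_mkcond; case: ifPn => yB.
  rewrite /= /Rintegral fineK//; apply: integrable_fin_num => //.
  apply: (@bounded_integrable _ _ _ _ _ _ M) => //.
  - apply: le_lt_trans Afin; apply: le_measure; rewrite ?inE//.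
    by move=> x; rewrite /ysection/= inE => /EAB[].
  - apply: (measurable_restrictT (fun x => f (x, y)) my).2.
    rewrite (_ : _ \_ _ = fun x => (f \_ E) (x, y)); first exact: measurable_fun_pair1.
    by apply/funext => x; rewrite !patchE mem_ysection.
  - by move=> x; rewrite /ysection/= inE => /fM.
rewrite (_ : ysection E y = set0) ?integral_set0//.
apply/seteqP; split => // x; rewrite /ysection/= inE => /EAB[/= _ By].
by move: yB; rewrite notin_setE.
Qed.

End bounded_fubini.

Lemma Rintegral_fubini d1 d2 (T1 : measurableType d1) (T2 : measurableType d2)
    (R : realType) (mu1 : {sigma_finite_measure set T1 -> \bar R})
    (mu2 : {sigma_finite_measure set T2 -> \bar R})
    (A : set T1) (B : set T2) (f : T1 * T2 -> R) (M : R) :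
  measurable A -> measurable B -> (mu1 A < +oo)%E -> (mu2 B < +oo)%E ->
  measurable_fun (A `*` B) f -> (forall z, (A `*` B) z -> `|f z| <= M) ->
  \int[mu1]_(x in A) \int[mu2]_(y in B) f (x, y) =
  \int[mu2]_(y in B) \int[mu1]_(x in A) f (x, y).
Proof.
move=> mA mB Af Bf mf fM.
have mAB : measurable (A `*` B) by exact: measurableX.
transitivity (\int[(mu1 \x mu2)%E]_(z in A `*` B) f z).
  rewrite (Rintegral_prod12 mA mB mAB Af Bf (@subset_refl _ _) mf fM).
  by apply: eq_Rintegral => x xA; rewrite in_xsectionX.
rewrite (Rintegral_prod21 mA mB mAB Af Bf (@subset_refl _ _) mf fM).
by apply: eq_Rintegral => y yB; rewrite in_ysectionX.
Qed.

(** * The pointwise estimate *)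

(** [acos] covers the upper half plane and [2 * pi - acos] the lower one. The angle is kept within
    one period because [Rintegral_period] will shift by it. *)
Lemma polar_surj (R : realType) (x y : R) :
  exists2 t, 0 <= t <= 2 * pi & (x, y) = polar (Num.sqrt (x ^+ 2 + y ^+ 2)) t.
Proof.
set r := Num.sqrt _.
have xy0 : 0 <= x ^+ 2 + y ^+ 2 by rewrite addr_ge0 ?sqr_ge0.
have r2 : r ^+ 2 = x ^+ 2 + y ^+ 2 by rewrite sqr_sqrtr.
have [r0|r0] := eqVneq r 0.
  exists 0; first by rewrite lexx mulr_ge0// pi_ge0.
  rewrite /polar r0 !mul0r.
  move: r2; rewrite r0 expr0n/= => /esym/eqP.
  by rewrite paddr_eq0 ?sqr_ge0// !sqrf_eq0 => /andP[/eqP-> /eqP->].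
have rp : 0 < r by rewrite lt_def r0 sqrtr_ge0.
have xr : -1 <= x / r <= 1.
  rewrite -ler_norml normrM normfV (gtr0_norm rp) ler_pdivrMr// mul1r.
  rewrite -sqrtr_sqr ler_sqrt// lerDl sqr_ge0//.
have sq : Num.sqrt (1 - (x / r) ^+ 2) = `|y| / r.
  have -> : 1 - (x / r) ^+ 2 = (y / r) ^+ 2.
    have yE : y ^+ 2 = r ^+ 2 - x ^+ 2 by rewrite r2; ring.
    by rewrite [(y / r) ^+ 2]expr_div_n yE; field.
  by rewrite sqrtr_sqr normrM normfV (gtr0_norm rp).
have a0 := acos_ge0 xr; have api := acos_lepi xr.
have [y0|y0] := leP 0 y.
  exists (acos (x / r)); first by rewrite a0/=; lra.
  rewrite /polar acosK ?in_itv//= sin_acos// sq ger0_norm//.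
  by congr pair; field.
exists (2 * pi - acos (x / r)); first by apply/andP; split; lra.
rewrite /polar addrC mulr_natl cosD2pi sinD2pi cosN sinN acosK ?in_itv//=.
by rewrite sin_acos// sq ltr0_norm//; congr pair; field.
Qed.

Section normc.
Context {R : realType}.

Lemma normc_ge0 (z : R[i]) : 0 <= normc z.
Proof. by case: z => *; exact: sqrtr_ge0. Qed.

Lemma normc_sqr (z : R[i]) : normc z ^+ 2 = complex.Re z ^+ 2 + complex.Im z ^+ 2.
Proof. by case: z => x y /=; rewrite sqr_sqrtr// addr_ge0 ?sqr_ge0. Qed.

Lemma normr_Re_le_normc (z : R[i]) : `|complex.Re z| <= normc z.
Proof. by case: z => x y /=; rewrite -sqrtr_sqr ler_wsqrtr// lerDl sqr_ge0. Qed.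

Lemma normr_Im_le_normc (z : R[i]) : `|complex.Im z| <= normc z.
Proof. by case: z => x y /=; rewrite -sqrtr_sqr ler_wsqrtr// lerDr sqr_ge0. Qed.

Lemma normc_le_ReIm (z : R[i]) : normc z <= `|complex.Re z| + `|complex.Im z|.
Proof.
case: z => x y /=; rewrite -[leRHS]ger0_norm ?addr_ge0// -sqrtr_sqr.
apply: ler_wsqrtr; rewrite sqrrD !real_normK ?num_real// -addrA lerD2l lerDr.
by rewrite mulrn_wge0 ?mulr_ge0.
Qed.

End normc.

(** This is s / (1 + s) with s = (1 - r)^2, in a form where monotonicity is that of the inverse. If
    |u| <= L / s and |a| <= L, then L / (|u| + |a|) is at least this number. *)
Definition weight {R : realType} (r : R) : R := 1 - (1 + (1 - r) ^+ 2)^-1.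

Section weight.
Context {R : realType}.
Implicit Types r s : R.

Lemma weight_den r : 0 < 1 + (1 - r) ^+ 2.
Proof. by rewrite ltr_pwDl// sqr_ge0. Qed.

Lemma weight_ge0 r : 0 <= weight r.
Proof. by rewrite /weight subr_ge0 invf_le1 ?weight_den// lerDl sqr_ge0. Qed.

Lemma weight_anti r s : r <= s -> s <= 1 -> weight s <= weight r.
Proof.
move=> rs s1; rewrite /weight lerD2l lerN2 lef_pV2 ?posrE ?weight_den//.
by rewrite lerD2l ler_sqr ?nnegrE; lra.
Qed.

(* A lower Riemann step function of [weight] with nodes [k / 5]. *)
Definition step_coef (k : nat) : R := weight (k.+1%:R / 5) - weight (k.+2%:R / 5).

Lemma step_coef_ge0 (k : 'I_4) : 0 <= step_coef k.
Proof.
rewrite subr_ge0 weight_anti ?ler_pM2r ?invr_gt0 ?ler_nat//.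
by rewrite ler_pdivrMr// mul1r ler_nat; exact: ltn_ord k.
Qed.

(** For [r] in [[j / 5, (j + 1) / 5)] only the terms with [k >= j] survive. They telescope to
    [weight ((j + 1) / 5)], because [weight 1 = 0], and [weight] decreases. *)
Lemma step_le_weight r : 0 <= r < 1 ->
  \sum_(k < 4) step_coef k * (r < k.+1%:R / 5)%R%:R <= weight r.
Proof.
move=> /andP[r0 r1].
have w5 : weight (5 / 5 : R) = 0 by rewrite /weight; field.
rewrite !big_ord_recl big_ord0 /= /step_coef /bump /= !add1n w5.
have [h1|h1] := ltP r (1 / 5).
  have := weight_anti (ltW h1); have -> : r < 2 / 5 by lra.
  have -> : r < 3 / 5 by lra. have -> : r < 4 / 5 by lra.
  by move=> /= H; have := H ltac:(lra); lra.
have [h2|h2] := ltP r (2 / 5).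
  have := weight_anti (ltW h2).
  have -> : r < 3 / 5 by lra. have -> : r < 4 / 5 by lra.
  by move=> /= H; have := H ltac:(lra); lra.
have [h3|h3] := ltP r (3 / 5).
  have := weight_anti (ltW h3). have -> : r < 4 / 5 by lra.
  by move=> /= H; have := H ltac:(lra); lra.
have [h4|h4] := ltP r (4 / 5).
  have := weight_anti (ltW h4).
  by move=> /= H; have := H ltac:(lra); lra.
by rewrite /= !mulr0 !addr0 weight_ge0.
Qed.

(** [(k.+1%:R / 5) ^+ 2] is the normalized area of the k-th disc, and the factor 2 is that of the
    pointwise gain. The right side is about 0.1715. Five is the least number of equal steps that
    works: four would give about 0.157. *)
Lemma step_mass :
  165 / 1000 <= 2 * \sum_(k < 4) step_coef k * (k.+1%:R / 5) ^+ 2 :> R.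
Proof.
rewrite !big_ord_recl big_ord0 /= /step_coef /bump /= !add1n.
have -> : weight (1 / 5 : R) = 16 / 41 by rewrite /weight; field.
have -> : weight (2 / 5 : R) = 9 / 34 by rewrite /weight; field.
have -> : weight (3 / 5 : R) = 4 / 29 by rewrite /weight; field.
have -> : weight (4 / 5 : R) = 1 / 26 by rewrite /weight; field.
have -> : weight (5 / 5 : R) = 0 by rewrite /weight; field.
lra.
Qed.

(* [2 (|z||a| + Re(z conj a)) = (|z| + |a|)^2 - |z - a|^2] and
   [Re(z conj a) <= |z||a|]. *)
Lemma normc_sub_le (z a : R[i]) (q : R) : 0 <= q ->
  q * (normc z + normc a) <= 1 ->
  normc (z - a) + 2 * q * (complex.Re z * complex.Re a + complex.Im z * complex.Im a)
    <= normc z + normc a.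
Proof.
case: z a => [X Y] [A B] q0; rewrite [complex.Re _]/= [complex.Im _]/=.
set n := normc _; set al := normc _ => qS /=.
set T := X * A + Y * B.
have n0 : 0 <= n by exact: sqrtr_ge0.
have al0 : 0 <= al by exact: sqrtr_ge0.
have n2 : n ^+ 2 = X ^+ 2 + Y ^+ 2 by rewrite sqr_sqrtr// addr_ge0 ?sqr_ge0.
have al2 : al ^+ 2 = A ^+ 2 + B ^+ 2 by rewrite sqr_sqrtr// addr_ge0 ?sqr_ge0.
have : `|T| <= n * al.
  rewrite -ler_sqr ?nnegrE ?mulr_ge0// real_normK ?num_real// exprMn n2 al2 /T.
  rewrite -subr_ge0.
  have -> : (X ^+ 2 + Y ^+ 2) * (A ^+ 2 + B ^+ 2) - (X * A + Y * B) ^+ 2 =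
    (X * B - Y * A) ^+ 2 by ring.
  exact: sqr_ge0.
rewrite ler_norml => /andP[NT TN].
have d2 : (X - A) ^+ 2 + (Y - B) ^+ 2 = (n + al) ^+ 2 - 2 * (n * al + T).
  by rewrite [(n + al) ^+ 2]sqrrD n2 al2 /T; ring.
rewrite -lerBrDr.
have S0 : 0 <= n + al by rewrite addr_ge0.
suff [R0 dR] : 0 <= n + al - 2 * q * T /\
    (X - A) ^+ 2 + (Y - B) ^+ 2 <= (n + al - 2 * q * T) ^+ 2.
  by rewrite -(ger0_norm R0) -sqrtr_sqr; exact: ler_wsqrtr.
(* For [T <= 0] the term [- 2 q T] only enlarges the bound, and [- (n * al) <= T] suffices. For
   [T > 0] the hypothesis on [q] gives [q (n + al) T <= T <= n * al]. *)
rewrite d2; have [T0|T0] := leP T 0.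
  have qT : 0 <= - (2 * q * T) by rewrite oppr_ge0 mulr_ge0_le0// mulr_ge0.
  by split; [lra|nra].
have qST : q * (n + al) * T <= T by nra.
have Sp : 0 < n + al.
  rewrite lt_def S0 andbT; apply/eqP => SE.
  have n00 : n = 0 by lra.
  by move: TN; rewrite n00 mul0r; lra.
split; last by nra.
(* After multiplication by [n + al], the claim follows from [(n + al)^2 >= 4 n al >= 4 T >= 2 q (n +
   al) T]. *)
by rewrite -(pmulr_rge0 _ Sp); nra.
Qed.

(** With b = al / L the bound reads 1 + b - 0.165 b^2 <= 1.835 on [0, 1]. The left side increases
    there, with equality at b = 1. *)
Lemma gain_le (L al k : R) : 0 <= al -> al <= L -> 165 / 1000 <= k ->
  L + (al - k * (al ^+ 2 / L)) <= 1835 / 1000 * L.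
Proof.
move=> al0 alL k165; have L0 : 0 <= L by exact: le_trans alL.
have kap : 165 / 1000 * (al ^+ 2 / L) <= k * (al ^+ 2 / L).
  by rewrite ler_wpM2r ?divr_ge0 ?sqr_ge0.
suff : L + al - 165 / 1000 * (al ^+ 2 / L) <= 1835 / 1000 * L by lra.
have [LE|Lneq] := eqVneq L 0.
  have -> : al = 0 by lra.
  by rewrite LE expr0n /= mul0r; lra.
have Lp : 0 < L by rewrite lt_def Lneq.
have b1 : al / L <= 1 by rewrite ler_pdivrMr// mul1r.
have alE : al = al / L * L by field.
have -> : al ^+ 2 / L = (al / L) ^+ 2 * L by field.
move: b1 alE (divr_ge0 al0 L0); set b := al / L => b1 -> b0.
(* This product is the factorization of 1.835 - (1 + b - 0.165 b^2). *)
have : 0 <= (1 - b) * (835 / 1000 - 165 / 1000 * b) by rewrite mulr_ge0; lra.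
nra.
Qed.

End weight.

(** * Lebesgue measure of the plane *)

Section plane.
Context {R : realType}.
Notation mR := (measurableTypeR R).
Notation m1 := (@lebesgue_measure R).
Notation m2 := (m1 \x m1)%E.
Notation D := (unit_disc R).
Notation mu := (area_measure R).

Definition disc (c : R * R) (d : R) : set (R * R) :=
  [set p | (p.1 - c.1) ^+ 2 + (p.2 - c.2) ^+ 2 < d ^+ 2].

Lemma measurable_disc c d : measurable (disc c d : set (mR * mR)).
Proof.
rewrite (_ : disc c d =
  (fun p : mR * mR => (p.1 - c.1) ^+ 2 + (p.2 - c.2) ^+ 2 : mR) @^-1` `]-oo, d ^+ 2[);
  last by apply/seteqP; split => p /=; rewrite in_itv.
rewrite -[X in measurable X]setTI.
have : measurable_fun [set: mR * mR]
    (fun p : mR * mR => (p.1 - c.1) ^+ 2 + (p.2 - c.2) ^+ 2 : mR).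
  apply: measurable_funD; apply: measurable_funX; apply: measurable_funB => //.
apply => //; exact: measurable_itv.
Qed.

Lemma lebesgue_measure_segment_fin (a b : R) : (m1 `[a, b] < +oo)%E.
Proof.
by rewrite /= lebesgue_measure_itv/=; case: ifPn => // _; rewrite -EFinB ltry.
Qed.

Lemma lebesgue_measure_shift (k : R) (A : set mR) : measurable A ->
  m1 ((fun x : mR => x + k : mR) @^-1` A) = m1 A.
Proof.
move=> mA.
have mf : @measurable_fun _ _ mR mR setT (fun x => x + k).
  exact: measurable_funD.
pose g : {mfun mR >-> mR} := @mfun_Sub _ _ mR mR _ (mem_set mf).
transitivity (pushforward m1 g A); first by [].
apply/esym/lebesgue_measure_unique => //= _ [[a b]] _ <-.
rewrite /pushforward/=.
have -> : (fun x : R => x + k) @^-1` `]a, b] = `]a - k, b - k]%classic.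
  by apply/seteqP; split => x /=; rewrite !in_itv /= ltrBlDr lerBrDr.
rewrite !lebesgue_measure_itv/= !lte_fin ltrD2r.
by case: ifPn => // _; rewrite -!EFinB; congr EFin; ring.
Qed.

(** * Rotations preserve plane measure *)

Definition plane_measure_preserving (T : mR * mR -> mR * mR) :=
  measurable_fun setT T /\ forall A, measurable A -> m2 (T @^-1` A) = m2 A.

Lemma measure_preserving_comp S T : plane_measure_preserving S ->
  plane_measure_preserving T -> plane_measure_preserving (S \o T).
Proof.
move=> [mS iS] [mT iT]; split; first exact: measurableT_comp.
move=> A mA; rewrite comp_preimage iT ?iS//.
by rewrite -[X in measurable X]setTI; exact: mS.
Qed.

(** [m2] is computed from vertical sections by definition. Horizontal sections are the ones that a
    horizontal shear translates. *)
Lemma product_measureC (A : set (mR * mR)) : measurable A ->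
  m2 A = (\int[m1]_y m1 (ysection A y))%E.
Proof.
move=> mA; transitivity ((m1 \x^ m1) A)%E => //.
by apply: product_measure_unique => // B C mB mC/=; rewrite product_measure2E.
Qed.

Lemma measure_preserving_shear2 (k : R) :
  plane_measure_preserving (fun p => (p.1, p.2 + k * p.1)).
Proof.
have mT : measurable_fun [set: mR * mR] (fun p : mR * mR => (p.1, p.2 + k * p.1) : mR * mR).
  apply: measurable_fun_pair => //; apply: measurable_funD => //.
  exact: measurable_funM.
split=> // A mA; rewrite /product_measure1; apply: eq_integral => x _ /=.
rewrite -(lebesgue_measure_shift (k * x) (measurable_xsection x mA)).
by congr (m1 _); apply/seteqP; split => y /=; rewrite /xsection/= !inE.
Qed.

Lemma measure_preserving_shear1 (k : R) :
  plane_measure_preserving (fun p => (p.1 + k * p.2, p.2)).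
Proof.
have mT : measurable_fun [set: mR * mR] (fun p : mR * mR => (p.1 + k * p.2, p.2) : mR * mR).
  apply: measurable_fun_pair => //; apply: measurable_funD => //.
  exact: measurable_funM.
split=> // A mA.
rewrite product_measureC; last by rewrite -[X in measurable X]setTI; exact: mT.
rewrite product_measureC//; apply: eq_integral => y _ /=.
rewrite -(lebesgue_measure_shift (k * y) (measurable_ysection y mA)).
by congr (m1 _); apply/seteqP; split => x /=; rewrite /ysection/= !inE.
Qed.

Definition rotation (t : R) (p : mR * mR) : mR * mR :=
  (cos t * p.1 - sin t * p.2, sin t * p.1 + cos t * p.2).

(* A rotation is a product of three shears. *)
Lemma measure_preserving_rotation_neq0 (t : R) : cos (t / 2) != 0 ->
  plane_measure_preserving (rotation t).
Proof.
(* The outer shears have slope - tan(t / 2) and the middle one has slope sin t. *)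
move=> c0; pose k := - (sin (t / 2) / cos (t / 2)).
have -> : rotation t = (fun p => (p.1 + k * p.2, p.2)) \o
    (fun p => (p.1, p.2 + sin t * p.1)) \o (fun p => (p.1 + k * p.2, p.2)).
  have cs := cos2Dsin2 (t / 2).
  have E : t = t / 2 + t / 2 by field.
  have ct : cos t = cos (t / 2) ^+ 2 - sin (t / 2) ^+ 2.
    by rewrite {1}E cosD !expr2.
  have st : sin t = 2 * (sin (t / 2) * cos (t / 2)) by rewrite {1}E sinD; ring.
  apply/funext => -[x y]; rewrite /rotation /= st ct /k.
  move: cs c0; move: (cos (t / 2)) (sin (t / 2)) => c s cs c0.
  have cs' : c ^+ 2 - s ^+ 2 = 1 - 2 * s ^+ 2 by lra.
  have sc : s ^+ 2 = 1 - c ^+ 2 by lra.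
  rewrite cs'; congr pair; last by field.
  have -> : x + - (s / c) * y + - (s / c) * (y + 2 * (s * c) * (x + - (s / c) * y))
    = x * (1 - 2 * s ^+ 2) - 2 * (s / c) * (1 - s ^+ 2) * y by field.
  by rewrite {3}sc; field.
apply: measure_preserving_comp; last exact: measure_preserving_shear1.
by apply: measure_preserving_comp;
  [exact: measure_preserving_shear1|exact: measure_preserving_shear2].
Qed.

(** Where tan(t / 2) is undefined, the rotation is performed as two rotations by t / 2. Their shears
    exist, since cos(t / 4) = 0 would give cos(t / 2) = -1 and not 0. *)
Lemma measure_preserving_rotation (t : R) : plane_measure_preserving (rotation t).
Proof.
have [c0|] := eqVneq (cos (t / 2)) 0; last exact: measure_preserving_rotation_neq0.
have -> : rotation t = rotation (t / 2) \o rotation (t / 2).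
  apply/funext => -[x y]; rewrite /rotation /= {1 2 3 4}(_ : t = t / 2 + t / 2); last by field.
  by rewrite cosD sinD; congr pair; ring.
suff H : cos (t / 2 / 2) != 0.
  by apply: measure_preserving_comp; exact: measure_preserving_rotation_neq0.
apply: contra_eq_neq c0 => c0.
rewrite (_ : t / 2 = t / 2 / 2 + t / 2 / 2); last by field.
rewrite cosD c0 mul0r sub0r oppr_eq0 -expr2.
have := cos2Dsin2 (t / 2 / 2); rewrite c0 expr0n/= add0r => ->.
exact: oner_neq0.
Qed.

(** The formula also covers the [x] outside the projection of the disc: the square root of a
    negative number is 0, and the open interval is then empty. *)
Lemma xsection_disc (c : R * R) (d x : R) : 0 <= d ->
  xsection (disc c d) x =
  `](c.2 - Num.sqrt (d ^+ 2 - (x - c.1) ^+ 2)),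
    (c.2 + Num.sqrt (d ^+ 2 - (x - c.1) ^+ 2))[%classic.
Proof.
move=> d0; apply/seteqP; split => y; rewrite /xsection /disc /= inE /= in_itv /=.
- move=> H.
  have : `|y - c.2| < Num.sqrt (d ^+ 2 - (x - c.1) ^+ 2).
    by rewrite -sqrtr_sqr ltr_sqrt ?(le_lt_trans (sqr_ge0 (y - c.2)))//; lra.
  by rewrite ltr_distl.
- rewrite -ltr_distl -sqrtr_sqr => H.
  have P : 0 < d ^+ 2 - (x - c.1) ^+ 2.
    rewrite ltNge; apply/negP => /ler0_sqrtr E; move: H.
    by rewrite E ltNge sqrtr_ge0.
  by move: H; rewrite ltr_sqrt// => H; lra.
Qed.

Lemma ysection_disc (c : R * R) (d y : R) : 0 <= d ->
  ysection (disc c d) y =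
  `](c.1 - Num.sqrt (d ^+ 2 - (y - c.2) ^+ 2)),
    (c.1 + Num.sqrt (d ^+ 2 - (y - c.2) ^+ 2))[%classic.
Proof.
move=> d0; rewrite -(@xsection_disc (c.2, c.1) d y d0).
by apply/seteqP; split => x; rewrite /xsection /ysection /disc /= !inE /= addrC.
Qed.

(** The substitution x = sin t turns the integrand into 2 cos(t)^2, a primitive of which is t + sin
    t cos t. *)
Lemma integral_semicircle :
  (\int[m1]_(x in `[(-1)%R, 1%R]) (2 * Num.sqrt (1 - x ^+ 2))%:E = (pi : R)%:E)%E.
Proof.
have p2 : 0 < (pi / 2 : R) by rewrite divr_gt0// pi_gt0.
have E1 : sin (pi / 2 : R) = 1 by exact: sin_pihalf.
have EN1 : sin (- (pi / 2) : R) = -1 by rewrite sinN sin_pihalf.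
have dsin : (@sin R)^`()%classic = cos.
  by apply/funext => x; rewrite derive1E; apply: derive_val.
transitivity (\int[m1]_(x in `[sin (- (pi / 2)), sin (pi / 2)])
    (2 * Num.sqrt (1 - x ^+ 2))%:E)%E; first by rewrite EN1 E1.
rewrite (@integration_by_substitution_increasing R sin
  (fun x => 2 * Num.sqrt (1 - x ^+ 2)) (- (pi / 2)) (pi / 2)).
- transitivity (\int[m1]_(x in `[(- (pi / 2) : R)%R, (pi / 2)%R]) (2 * cos x ^+ 2)%:E)%E.
    apply: eq_integral => x; rewrite inE /= in_itv/= => /andP[x1 x2].
    congr EFin; rewrite /GRing.mul/= dsin -/(GRing.mul _ _) -cos2sin2 sqrtr_sqr.
    by rewrite ger0_norm ?cos_ge0_pihalf ?x1// -mulrA -expr2.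
  rewrite (@continuous_FTC2 R (fun x => 2 * cos x ^+ 2)
    (fun x => x + sin x * cos x)).
  + by rewrite sinN cosN cos_pihalf !mulr0 !addr0 -EFinB; congr EFin; field.
  + lra.
  + apply: continuous_subspaceT => x; apply: cvgM; first exact: cvg_cst.
    by rewrite (_ : (fun x => cos x ^+ 2) = (fun x => cos x * cos x));
      [apply: cvgM; exact: continuous_cos|apply/funext => y; rewrite expr2].
  + split.
    * by move=> x _; apply: ex_derive.
    * apply: cvg_at_right_filter; apply: cvgD; first exact: cvg_id.
      by apply: cvgM; [exact: continuous_sin|exact: continuous_cos].
    * apply: cvg_at_left_filter; apply: cvgD; first exact: cvg_id.
      by apply: cvgM; [exact: continuous_sin|exact: continuous_cos].
  + move=> x _; rewrite derive1E.
    have H : is_derive x 1 (fun x : R => x + sin x * cos x) (2 * cos x ^+ 2).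
      apply: is_derive_eq.
      have := sin2cos2 x; rewrite /GRing.scale/= => sc.
      rewrite mulrN -expr2 sc; ring.
    exact: derive_val.
- lra.
- move=> x y; rewrite !in_itv/= => X Y xy.
  by rewrite ltr_sin ?in_itv//=.
- by move=> x _; rewrite dsin; exact: continuous_cos.
- by rewrite dsin; apply: cvgP; apply: cvg_at_right_filter; exact: continuous_cos.
- by rewrite dsin; apply: cvgP; apply: cvg_at_left_filter; exact: continuous_cos.
- split.
  + by move=> x _; exact: derivable_sin.
  + by apply: cvg_at_right_filter; exact: continuous_sin.
  + by apply: cvg_at_left_filter; exact: continuous_sin.
- apply: continuous_subspaceT => x; apply: cvgM; first exact: cvg_cst.
  apply: continuous_cvg; first exact: sqrt_continuous.
  by apply: cvgB; [exact: cvg_cst|exact: exprn_continuous].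
Qed.

Lemma area_disc (c : R * R) (d : R) : 0 < d ->
  (m2 (disc c d) = (pi * d ^+ 2)%:E)%E.
Proof.
move=> d0; rewrite /= /product_measure1.
pose G x := 2 * Num.sqrt (d ^+ 2 - (x - c.1) ^+ 2).
have mG : {within `[(c.1 + d * -1), (c.1 + d * 1)], continuous G}.
  apply: continuous_subspaceT => x; apply: cvgM; first exact: cvg_cst.
  apply: continuous_cvg; first exact: sqrt_continuous.
  apply: cvgB; first exact: cvg_cst.
  rewrite (_ : (fun x => (x - c.1) ^+ 2) = (fun x => (x - c.1) * (x - c.1))).
    by rewrite expr2; apply: cvgM; (apply: cvgB; [exact: cvg_id|exact: cvg_cst]).
  by apply/funext => y; rewrite expr2.
(* [G x] is the length of the section at [x], equal to 0 off the projection of the disc. The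
   endpoints are written as values of [t |-> c.1 + d * t], ready for the substitution. *)
transitivity (\int[m1]_(x in `[(c.1 + d * -1)%R, (c.1 + d * 1)%R]) (G x)%:E)%E.
  rewrite [RHS]integral_mkcond; apply: eq_integral => x _.
  rewrite /= xsection_disc ?ltW// lebesgue_measure_itv/= lte_fin.
  have s0 := sqrtr_ge0 (d ^+ 2 - (x - c.1) ^+ 2).
  rewrite [LHS](_ : _ = (G x)%:E); last first.
    case: ifPn => [_|]; first by rewrite -EFinB /G; congr EFin; ring.
    by rewrite -leNgt => H; rewrite /G; congr EFin; lra.
  rewrite patchE; case: ifPn => // /negP; rewrite inE /= in_itv/= => H.
  congr EFin; rewrite /G ler0_sqrtr ?mulr0// subr_le0.
  move/negP: H; rewrite mulr1 mulrN1 -ler_distl -ltNge => H.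
  by rewrite -(real_normK (num_real (x - c.1))) ler_sqr ?nnegrE //; exact: ltW.
set F := fun t : R => c.1 + d * t.
have dF : F^`()%classic = cst d.
  apply/funext => t; rewrite derive1E /F.
  have H : is_derive t 1 (fun t : R => c.1 + d * t) d.
    by apply: is_derive_eq; rewrite add0r mul1r /GRing.scale/= mulr1.
  by rewrite derive_val.
have cF : continuous F.
  move=> t; apply: cvgD; first exact: cvg_cst.
  by apply: cvgM; [exact: cvg_cst|exact: cvg_id].
rewrite (@integration_by_substitution_increasing R F G (-1) 1)//.
- transitivity (\int[m1]_(t in `[(-1)%R, 1%R]) ((d ^+ 2)%:E * (2 * Num.sqrt (1 - t ^+ 2))%:E))%E.
    apply: eq_integral => t _; rewrite -EFinM; congr EFin.
    change (G (F t) * F^`()%classic t = d ^+ 2 * (2 * Num.sqrt (1 - t ^+ 2))).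
    rewrite dF /cst /G /F (_ : d ^+ 2 - _ = d ^+ 2 * (1 - t ^+ 2)); last by ring.
    by rewrite sqrtrM ?sqr_ge0// sqrtr_sqr gtr0_norm//; ring.
  rewrite ge0_integralZl// ?lee_fin ?sqr_ge0//.
  + by rewrite integral_semicircle -EFinM mulrC.
  + apply/measurable_EFinP; apply: measurable_funTS.
    apply: continuous_measurable_fun => x; apply: cvgM; first exact: cvg_cst.
    apply: continuous_cvg; first exact: sqrt_continuous.
    by apply: cvgB; [exact: cvg_cst|exact: exprn_continuous].
- by move=> x y ? ? xy; rewrite /F ltrD2l ltr_pM2l.
- by rewrite dF => x _; exact: cvg_cst.
- by rewrite dF; apply: is_cvg_cst.
- by rewrite dF; apply: is_cvg_cst.
- split.
  + by move=> x _; apply: ex_derive.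
  + by apply: cvg_at_right_filter; exact: cF.
  + by apply: cvg_at_left_filter; exact: cF.
Qed.

Lemma unit_discE : D = disc (0, 0) 1.
Proof. by apply/seteqP; split => p; rewrite /unit_disc /disc /= expr1n !subr0. Qed.

Lemma measurable_unit_disc : measurable (D : set (mR * mR)).
Proof. by rewrite unit_discE; exact: measurable_disc. Qed.

Lemma area_measure_disc c (d : R) : 0 < d -> mu (disc c d) = (d ^+ 2)%:E.
Proof.
move=> d0; transitivity ((pi^-1)%:E * m2 (disc c d))%E; first by [].
rewrite area_disc// -EFinM mulrA mulVf ?mul1r//.
by rewrite gt_eqF// pi_gt0.
Qed.

Lemma disc0P (rho : R) (p : R * R) : 0 < rho ->
  disc (0, 0) rho p <-> Num.sqrt (p.1 ^+ 2 + p.2 ^+ 2) < rho.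
Proof.
move=> rho0; rewrite /disc /= !subr0 -[X in _ <-> _ < X](gtr0_norm rho0) -sqrtr_sqr.
by rewrite ltr_sqrt// exprn_gt0.
Qed.

Lemma disc0_polar (rho r t : R) : 0 < rho -> 0 <= r ->
  disc (0, 0) rho (polar r t) <-> r < rho.
Proof.
move=> rho0 r0; rewrite disc0P// /polar /= !exprMn -mulrDr cos2Dsin2 mulr1.
by rewrite sqrtr_sqr ger0_norm.
Qed.

Lemma unit_disc_polar p : D p -> exists r t, 0 <= r < 1 /\ p = polar r t.
Proof.
rewrite unit_discE disc0P// => p1; case: p p1 => x y /= p1.
have [t _ E] := polar_surj x y.
by exists (Num.sqrt (x ^+ 2 + y ^+ 2)), t; rewrite sqrtr_ge0.
Qed.

Lemma disc_sub_unit_disc (rho : R) : 0 < rho <= 1 -> disc (0, 0) rho `<=` D.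
Proof.
move=> /andP[r0 r1] p; rewrite unit_discE !disc0P// => /lt_le_trans; exact.
Qed.

(** * From disc means to the norm estimate *)

Section L1.
Variable u : R * R -> R[i].
Hypothesis uL : L1_disc R u.

Lemma measurable_normc (v : R * R -> R[i]) :
  measurable_fun (D : set (mR * mR)) (fun p => complex.Re (v p)) ->
  measurable_fun (D : set (mR * mR)) (fun p => complex.Im (v p)) ->
  measurable_fun (D : set (mR * mR)) (fun p => normc (v p)).
Proof.
move=> mRe mIm.
rewrite (_ : (fun p => normc (v p)) =
  Num.sqrt \o (fun p => complex.Re (v p) ^+ 2 + complex.Im (v p) ^+ 2)); last first.
  by apply/funext => p /=; case: (v p).
apply: measurableT_comp; first exact: continuous_measurable_fun (@sqrt_continuous R).
by apply: measurable_funD; exact: measurable_funX.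
Qed.

Lemma measurable_Re : measurable_fun (D : set (mR * mR)) (fun p => complex.Re (u p)).
Proof. by case: uL => /measurable_int/measurable_EFinP. Qed.

Lemma measurable_Im : measurable_fun (D : set (mR * mR)) (fun p => complex.Im (u p)).
Proof. by case: uL => _ /measurable_int/measurable_EFinP. Qed.

Lemma integrable_normc : mu.-integrable D (fun p => (normc (u p))%:E).
Proof.
have [iRe iIm] := uL.
pose g (p : mR * mR) := (`|complex.Re (u p)| + `|complex.Im (u p)|)%:E.
refine (le_integrable measurable_unit_disc _ (g := g) _ _).
- apply/measurable_EFinP; apply: measurable_normc; first exact: measurable_Re.
  exact: measurable_Im.
- move=> p _ /=; rewrite lee_fin ger0_norm; last by case: (u p) => *; exact: sqrtr_ge0.
  by rewrite [leRHS]ger0_norm ?addr_ge0// normc_le_ReIm.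
- exact: (integrableD measurable_unit_disc
    (integrable_norm (f := fun p : mR * mR => complex.Re (u p)) iRe)
    (integrable_norm (f := fun p : mR * mR => complex.Im (u p)) iIm)).
Qed.

Lemma L1norm_fin : L1norm u = (fine (L1norm u))%:E.
Proof.
rewrite fineK// /L1norm; apply: integrable_fin_num => //.
  exact: measurable_unit_disc.
exact: integrable_normc.
Qed.

Lemma L1norm_ge0 : (0 <= L1norm u)%E.
Proof.
by apply: integral_ge0 => p _; rewrite lee_fin; case: (u p) => *; exact: sqrtr_ge0.
Qed.

End L1.

Lemma integrable_lin2 (nu : {measure set (mR * mR) -> \bar R}) (E : set (mR * mR))
    (f g : mR * mR -> R) (a b : R) : measurable E ->
  nu.-integrable E (EFin \o f) -> nu.-integrable E (EFin \o g) ->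
  nu.-integrable E (EFin \o (fun p => f p * a + g p * b)).
Proof.
move=> mE fi gi.
exact: (integrableD mE (integrableZr mE a fi) (integrableZr mE b gi)).
Qed.

Lemma L1norm_Bop_le (u : R * R -> R[i]) : L1_disc R u ->
  (forall r t : R, 0 <= r < 1 ->
    ((normc (u (polar r t)))%:E <= ((1 - r) ^- 2)%:E * L1norm u)%E) ->
  (forall rho : R, 0 < rho < 1 ->
    \int[mu]_(p in disc (0, 0) rho) complex.Re (u p) = rho ^+ 2 * complex.Re (u (0, 0)) /\
    \int[mu]_(p in disc (0, 0) rho) complex.Im (u p) = rho ^+ 2 * complex.Im (u (0, 0))) ->
  (L1norm (Bop u) <= (1835 / 1000 : R)%:E * L1norm u)%E.
Proof.
move=> uL ub um.
have mD := @measurable_unit_disc.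
have [iRe iIm] := uL.
have LE := L1norm_fin uL; set L := fine (L1norm u) in LE.
have L0 : 0 <= L by rewrite fine_ge0// L1norm_ge0.
set a := u (0, 0) in um; set al := normc a.
have al0 : 0 <= al := normc_ge0 a.
have ub' r t : 0 <= r < 1 -> normc (u (polar r t)) <= (1 - r) ^- 2 * L.
  by move=> r01; rewrite -lee_fin EFinM -LE; exact: ub.
(* This is the growth bound at the origin. *)
have alL : al <= L.
  have := @ub' 0 0; rewrite /polar !mul0r subr0 expr1n invr1 mul1r; apply.
  by rewrite lexx ltr01.
pose rk (k : 'I_4) : R := k.+1%:R / 5.
have rk0 k : 0 < rk k < 1.
  by rewrite divr_gt0//= ltr_pdivrMr// mul1r ltr_nat ltnS ltn_ord.
pose T (p : mR * mR) := complex.Re (u p) * complex.Re a + complex.Im (u p) * complex.Im a.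
pose h (k : 'I_4) := T \_ (disc (0, 0) (rk k)).
(* Dividing by [L] replaces the normalization [L = 1]. If [L = 0], the inverse is 0 and all [q k]
   vanish, which is consistent since then [al = 0]. *)
pose q (k : 'I_4) := 2 / L * step_coef k.
(* A pointwise majorant of |u - a| whose integral is computable from the norm and the disc means
   alone. *)
pose g p := normc (u p) + (al - \sum_(k < 4) q k * h k p).
have Ti : mu.-integrable D (EFin \o T) by exact: integrable_lin2.
have hi k : mu.-integrable D (EFin \o h k).
  have mk : measurable (disc (0, 0) (rk k) : set (mR * mR)) by exact: measurable_disc.
  have := (integrable_restrict mu mk mD (EFin \o T)).1.
  rewrite restrict_EFin; apply.
  by apply: integrableS Ti => //; exact: measurableI.
have qhi k : mu.-integrable D (EFin \o (fun p => q k * h k p)).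
  exact: (integrableZl mD (q k) (hi k)).
have Ih k : \int[mu]_(p in D) h k p = rk k ^+ 2 * al ^+ 2.
  rewrite -Rintegral_mkcondr setIidr; last first.
    by apply: disc_sub_unit_disc; have /andP[-> /ltW->] := rk0 k.
  have mk : measurable (disc (0, 0) (rk k) : set (mR * mR)) by exact: measurable_disc.
  have sub : disc (0, 0) (rk k) `<=` D.
    by apply: disc_sub_unit_disc; have /andP[-> /ltW->] := rk0 k.
  have iRek := integrableS mD mk sub iRe.
  have iImk := integrableS mD mk sub iIm.
  rewrite /T RintegralD//; last 2 first.
  - exact: (integrableZr mk _ iRek).
  - exact: (integrableZr mk _ iImk).
  rewrite !RintegralZr//; have [-> ->] := um _ (rk0 k).
  by rewrite normc_sqr -/a; ring.
have ui := integrable_normc uL.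
have ci : mu.-integrable D (EFin \o cst al).
  apply: measurable_bounded_integrable => //.
    by rewrite unit_discE area_measure_disc// ltry.
  exists al; split; first exact: num_real.
  by move=> M alM x _ /=; rewrite ger0_norm// ltW.
have si : mu.-integrable D (EFin \o (fun p => \sum_(k < 4) q k * h k p)).
  exact: integrable_Rsum.
have gi : mu.-integrable D (EFin \o g).
  exact: (integrableD mD ui (integrableB mD ci si)).
have muD : fine (mu D) = 1 by rewrite unit_discE area_measure_disc//= expr1n.
have Ig : (\int[mu]_(p in D) (g p)%:E =
    (L + (al - \sum_(k < 4) q k * (rk k ^+ 2 * al ^+ 2)))%:E)%E.
  rewrite -[LHS]fineK; last exact: integrable_fin_num.
  congr EFin; rewrite -/(Rintegral mu D g) RintegralD//; last first.
    exact: (integrableB mD ci si).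
  congr (_ + _); rewrite RintegralB// Rintegral_cst// muD mulr1 Rintegral_sum//.
  by congr (_ - _); apply: eq_bigr => k _; rewrite RintegralZl// Ih.
have pw p : D p -> normc (Bop u p) <= g p.
  move=> /unit_disc_polar [r [t [r01 ->]]]; have /andP[r0 r1] := r01.
  have hE k : h k (polar r t) = (r < rk k)%R%:R * T (polar r t).
    rewrite /h patchE; have rkk : 0 < rk k by have /andP[] := rk0 k.
    case: ifPn => [|/negP]; rewrite inE disc0_polar//.
      by move=> ->; rewrite mul1r.
    by move=> /negP/negbTE ->; rewrite mul0r.
  rewrite /g; under eq_bigr do rewrite hE mulrA.
  pose S : R := \sum_(k < 4) step_coef k * (r < rk k)%R%:R.
  have -> : \sum_(k < 4) q k * (r < rk k)%R%:R * T (polar r t) =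
      2 * (S / L) * T (polar r t).
    rewrite -mulr_suml; congr (_ * _); rewrite /S mulr_suml mulr_sumr.
    by apply: eq_bigr => k _; rewrite /q; ring.
  rewrite addrA lerBrDr; apply: normc_sub_le.
    rewrite divr_ge0// sumr_ge0// => k _.
    by rewrite mulr_ge0 ?step_coef_ge0.
  have [->|Lneq] := eqVneq L 0; first by rewrite invr0 mulr0 mul0r.
  have Lp : 0 < L by rewrite lt_def Lneq.
  have nul := ub' r t r01.
  rewrite -/al.
  have Sw : S <= weight r by exact: step_le_weight.
  have s0 : 0 < (1 - r) ^+ 2 by rewrite exprn_gt0// subr_gt0.
  have n0 := normc_ge0 (u (polar r t)).
  (* The growth bound is used for |u| and [alL] for |a|. The resulting product is exactly 1, the
     equation from which [weight] was chosen. *)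
  apply: (@le_trans _ _ (weight r / L * ((1 - r) ^- 2 * L + L))).
    apply: ler_pM.
    - rewrite divr_ge0// sumr_ge0// => k _.
      by rewrite mulr_ge0 ?step_coef_ge0.
    - by rewrite addr_ge0.
    - by rewrite ler_pM2r ?invr_gt0.
    - exact: lerD.
  have := weight_den r; rewrite /weight; move: s0; set s := (1 - r) ^+ 2 => s0 s1.
  rewrite le_eqVlt; apply/orP; left; apply/eqP.
  by field; rewrite !gt_eqF.
have gm : measurable_fun (D : set (mR * mR)) g.
  by apply/measurable_EFinP; exact: measurable_int gi.
apply: (@le_trans _ _ (\int[mu]_(p in D) (g p)%:E)%E).
  apply: ge0_le_integral => //.
  - by move=> p _; rewrite lee_fin normc_ge0.
  - apply/measurable_EFinP; apply: measurable_normc.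
    + rewrite (_ : (fun p => _) = (fun p => complex.Re (u p) - complex.Re a)).
        by apply: measurable_funB => //; exact: measurable_Re.
      by apply/funext => p; rewrite /Bop raddfB.
    + rewrite (_ : (fun p => _) = (fun p => complex.Im (u p) - complex.Im a)).
        by apply: measurable_funB => //; exact: measurable_Im.
      by apply/funext => p; rewrite /Bop raddfB.
  - exact/measurable_EFinP.
rewrite Ig LE -EFinM lee_fin.
have -> : \sum_(k < 4) q k * (rk k ^+ 2 * al ^+ 2) =
    (2 * \sum_(k < 4) step_coef k * rk k ^+ 2) * (al ^+ 2 / L).
  rewrite mulrAC mulr_sumr; apply: eq_bigr => k _.
  by rewrite /q; ring.
by apply: gain_le => //; exact: step_mass.
Qed.

(** * Disc means from circle means *)

Lemma Rintegral_shift (g : mR -> R) (a b k M : R) :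
  measurable_fun setT g -> (forall x, `|g x| <= M) ->
  \int[m1]_(x in `[a, b]) g (x + k) = \int[m1]_(x in `[a + k, b + k]) g x.
Proof.
move=> mg gM.
rewrite (_ : `[a, b]%classic = (fun x : mR => x + k : mR) @^-1` `[a + k, b + k]%classic).
  apply: (@Rintegral_preserving _ _ _ m1 (fun x : mR => x + k : mR) _ g M) => //.
  - exact: measurable_funD.
  - by move=> B mB; exact: lebesgue_measure_shift.
  - exact: lebesgue_measure_segment_fin.
  - exact: measurable_funTS.
by apply/seteqP; split => x /=; rewrite !in_itv/= !lerD2r.
Qed.

(** The shifted interval [[k, p + k]] is cut at [p], and the part beyond [p] is moved back by one
    period onto [[0, k]]. *)
Lemma Rintegral_period (g : mR -> R) (p k M : R) : 0 <= k <= p ->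
  measurable_fun setT g -> (forall x, `|g x| <= M) ->
  (forall x, g (x + p) = g x) ->
  \int[m1]_(x in `[0, p]) g (x + k) = \int[m1]_(x in `[0, p]) g x.
Proof.
move=> /andP[k0 kp] mg gM gp.
have ig a b : m1.-integrable `[a, b] (EFin \o g).
  apply: (@bounded_integrable _ _ _ _ _ _ M) => //.
  - exact: lebesgue_measure_segment_fin.
  - exact: measurable_funTS.
have iog a b : m1.-integrable `]a, b] (EFin \o g).
  by apply: integrableS (ig a b) => //; exact: subset_itv_oc_cc.
have split a b c : a <= b -> b <= c -> \int[m1]_(x in `[a, c]) g x =
    \int[m1]_(x in `[a, b]) g x + \int[m1]_(x in `[b, c]) g x.
  move=> ab bc; have := @Rintegral_itvB R g (BLeft a) (BRight c) b (ig a c).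
  rewrite !bnd_simp => /(_ ab bc); rewrite Rintegral_itv_obnd_cbnd//; lra.
rewrite (Rintegral_shift _ _ _ mg gM) add0r (split k p (p + k))//; last by lra.
have -> : \int[m1]_(x in `[p, (p + k)]) g x = \int[m1]_(x in `[0, k]) g x.
  have := Rintegral_shift 0 k p mg gM; rewrite add0r (addrC k) => <-.
  by apply: eq_Rintegral => x _; rewrite gp.
by rewrite (split 0 k p)//; lra.
Qed.

(* An alias, since no sigma-finite structure is inferred for [m2]. *)
Definition plane_lebesgue : set (mR * mR)%type -> \bar R := (m1 \x m1)%E.
HB.instance Definition _ := Measure.copy plane_lebesgue m2.

Lemma plane_lebesgue_sigma_finite : sigma_finite [set: (mR * mR)%type] plane_lebesgue.
Proof.
exists (fun n => disc (0, 0) n.+1%:R).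
  apply/seteqP; split => // p _.
  exists (Num.truncn (Num.sqrt (p.1 ^+ 2 + p.2 ^+ 2))) => //.
  apply/disc0P => //; exact: truncnS_gt.
move=> n; split; first exact: measurable_disc.
by rewrite /plane_lebesgue area_disc// ltry.
Qed.

HB.instance Definition _ := Measure_isSigmaFinite.Build _ _ _ plane_lebesgue
  plane_lebesgue_sigma_finite.

Lemma Rintegral_area (E : set (mR * mR)) (f : mR * mR -> R) : measurable E ->
  m2.-integrable E (EFin \o f) ->
  \int[mu]_(p in E) f p = pi^-1 * \int[m2]_(p in E) f p.
Proof.
move=> mE fi; have mf := measurable_int _ fi.
have pos_fin := integrable_pos_fin_num mE fi.
have neg_fin := integrable_neg_fin_num mE fi.
have pE : (\int[mu]_(p in E) (EFin \o f)^\+ p =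
    (pi^-1)%:E * \int[m2]_(p in E) (EFin \o f)^\+ p)%E.
  by apply: (@ge0_integral_mscale _ _ _ m2 _ mE (NngNum (inv_pi_ge0 R))) => //;
    exact: measurable_funepos.
have nE : (\int[mu]_(p in E) (EFin \o f)^\- p =
    (pi^-1)%:E * \int[m2]_(p in E) (EFin \o f)^\- p)%E.
  by apply: (@ge0_integral_mscale _ _ _ m2 _ mE (NngNum (inv_pi_ge0 R))) => //;
    exact: measurable_funeneg.
have IE : (\int[mu]_(p in E) (EFin \o f) p =
    (pi^-1)%:E * \int[m2]_(p in E) (EFin \o f) p)%E.
  rewrite [LHS]integralE pE nE -muleBr ?fin_num_adde_defl ?fin_numN//.
  by congr (_ * _)%E; exact/esym/integralE.
by rewrite /Rintegral [X in fine X = _]IE fineM//; exact: integrable_fin_num.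
Qed.

Lemma rotation_polar (r t s : R) : rotation t (polar r s) = polar r (s + t).
Proof. by rewrite /rotation /polar /= cosD sinD; congr pair; ring. Qed.

Lemma rotation_disc (rho t : R) : rotation t @^-1` disc (0, 0) rho = disc (0, 0) rho.
Proof.
have E p : (rotation t p).1 ^+ 2 + (rotation t p).2 ^+ 2 = p.1 ^+ 2 + p.2 ^+ 2.
  rewrite /rotation /= -[RHS]mulr1 -(cos2Dsin2 t); ring.
by apply/seteqP; split => p; rewrite /disc /= !subr0 E.
Qed.

(** The value at [rotation t p] is integrated over [p] in the disc and [t] in [[0, 2 * pi]]. With
    [t] inside, one gets circle integrals, all equal to [2 * pi * f (0, 0)]. With [p] inside,
    invariance makes the integral over [p] independent of [t]. *)
Lemma disc_mean_of_circle_mean (f : R * R -> R) (rho M : R) : 0 < rho < 1 ->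
  measurable_fun (D : set (mR * mR)) f ->
  (forall p, disc (0, 0) rho p -> `|f p| <= M) ->
  (forall r, 0 <= r < 1 ->
     \int[m1]_(t in `[0, 2 * pi]) f (polar r t) = 2 * pi * f (0, 0)) ->
  \int[m2]_(p in disc (0, 0) rho) f p = pi * rho ^+ 2 * f (0, 0).
Proof.
move=> /andP[rho0 rho1] mf fM cm.
set B := disc (0, 0) rho.
have mB : measurable (B : set (mR * mR)) by exact: measurable_disc.
have BD : B `<=` D by apply: disc_sub_unit_disc; rewrite rho0 ltW.
have Bfin : (m2 B < +oo)%E by rewrite area_disc// ltry.
have M0 : 0 <= M.
  apply: le_trans (fM (0, 0) _); first exact: normr_ge0.
  by rewrite /disc /= subrr expr0n /= addr0 exprn_gt0.
(* Extended by 0, the function is measurable and bounded on the whole plane, so it can be composed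
   with every rotation. *)
pose F := f \_ B.
have mfB : measurable_fun (B : set (mR * mR)) f.
  by apply: measurable_funS mf => //; exact: measurable_unit_disc.
have mF : measurable_fun [set: mR * mR] F by exact/(measurable_restrictT _ mB).
have FM p : `|F p| <= M.
  by rewrite /F patchE; case: ifPn => [/set_mem/fM//|_]; rewrite normr0.
have p2 : 0 < 2 * pi :> R by rewrite mulr_gt0// pi_gt0.
pose I := `[0, 2 * pi]%classic : set mR.
have mI : measurable I by exact: measurable_itv.
have Ifin : (m1 I < +oo)%E.
  exact: lebesgue_measure_segment_fin.
have mrot : measurable_fun [set: (mR * mR) * mR]
    (fun z : (mR * mR) * mR => rotation z.2 z.1 : mR * mR).
  have mc : measurable_fun [set: (mR * mR) * mR] (fun z => cos z.2 : mR).
    by apply: measurableT_comp => //; exact: continuous_measurable_fun (@continuous_cos R).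
  have ms : measurable_fun [set: (mR * mR) * mR] (fun z => sin z.2 : mR).
    by apply: measurableT_comp => //; exact: continuous_measurable_fun (@continuous_sin R).
  have m11 : measurable_fun [set: (mR * mR) * mR] (fun z => z.1.1 : mR).
    exact: measurableT_comp.
  have m12 : measurable_fun [set: (mR * mR) * mR] (fun z => z.1.2 : mR).
    exact: measurableT_comp.
  apply: measurable_fun_pair.
    by apply: measurable_funB; apply: measurable_funM.
  by apply: measurable_funD; apply: measurable_funM.
have mG : measurable_fun (B `*` I) (fun z : (mR * mR) * mR => F (rotation z.2 z.1)).
  by apply: measurable_funTS; exact: measurableT_comp.
have fub : \int[m2]_(p in B) \int[m1]_(t in I) F (rotation t p) =
    \int[m1]_(t in I) \int[m2]_(p in B) F (rotation t p).
  have H := (@Rintegral_fubini _ _ _ _ R plane_lebesgue m1 B I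
    (fun z => F (rotation z.2 z.1)) M mB mI Bfin Ifin mG (fun z _ => FM _)).
  exact H.
move: fub.
have -> : \int[m2]_(p in B) \int[m1]_(t in I) F (rotation t p) =
    \int[m2]_(p in B) (2 * pi * f (0, 0)).
  apply: eq_Rintegral => -[x y] /set_mem pB.
  have [s s2 E] := polar_surj x y; set r := Num.sqrt _ in E.
  have r0 : 0 <= r by exact: sqrtr_ge0.
  have rrho : r < rho by apply/(disc0_polar s rho0 r0); rewrite -E.
  have r1 : 0 <= r < 1 by rewrite r0 (lt_trans rrho).
  have FE t : F (polar r t) = f (polar r t).
    by rewrite /F patchE mem_set//; exact/disc0_polar.
  rewrite -(cm r r1) E.
  under eq_Rintegral do rewrite rotation_polar addrC.
  (* The orbit of the point starts at its own angle [s]; periodicity moves the start to angle 0. *)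
  rewrite (@Rintegral_period (fun t => F (polar r t)) _ _ M)//.
  - by apply: eq_Rintegral => t _; rewrite FE.
  - apply: measurableT_comp => //; apply: measurable_fun_pair; apply: measurable_funM => //.
      exact: continuous_measurable_fun (@continuous_cos R).
    exact: continuous_measurable_fun (@continuous_sin R).
  - by move=> t; rewrite /polar mulr_natl cosD2pi sinD2pi.
have -> : \int[m1]_(t in I) \int[m2]_(p in B) F (rotation t p) =
    \int[m1]_(t in I) \int[m2]_(p in B) f p.
  apply: eq_Rintegral => t _; have [mt it] := measure_preserving_rotation t.
  transitivity (\int[m2]_(p in rotation t @^-1` B) F (rotation t p)).
    by rewrite rotation_disc.
  rewrite (@Rintegral_preserving _ _ _ m2 (rotation t) B F M)//; last first.
    exact: measurable_funTS.
  by apply: eq_Rintegral => p pB; rewrite /F patchE pB.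
rewrite !Rintegral_cst//= area_disc//= lebesgue_measure_itv/= lte_fin p2 /=.
rewrite subr0 => H; apply: (mulIf (lt0r_neq0 p2)); rewrite -H; ring.
Qed.

Lemma Rintegral_area_disc_mean (f : R * R -> R) (rho : R) : 0 < rho ->
  m2.-integrable (disc (0, 0) rho) (EFin \o f) ->
  \int[m2]_(p in disc (0, 0) rho) f p = pi * rho ^+ 2 * f (0, 0) ->
  \int[mu]_(p in disc (0, 0) rho) f p = rho ^+ 2 * f (0, 0).
Proof.
move=> rho0 fi E; rewrite Rintegral_area//; last exact: measurable_disc.
by rewrite E !mulrA mulVf ?mul1r// gt_eqF// pi_gt0.
Qed.

Lemma circle_mean_L1norm_Bop_le (u : R * R -> R[i]) : L1_disc R u ->
  (forall r t : R, 0 <= r < 1 ->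
    ((normc (u (polar r t)))%:E <= ((1 - r) ^- 2)%:E * L1norm u)%E) ->
  (forall r s : R, 0 <= r < 1 -> 0 <= s < 1 -> circle_mean u r = circle_mean u s) ->
  (L1norm (Bop u) <= (1835 / 1000 : R)%:E * L1norm u)%E.
Proof.
move=> uL ub cm; apply: L1norm_Bop_le => // rho rho01; have /andP[rho0 rho1] := rho01.
have LE := L1norm_fin uL; set L := fine (L1norm u) in LE.
have L0 : 0 <= L by rewrite fine_ge0// L1norm_ge0.
(* Since [rho < 1], the growth bound is uniform on the smaller disc, which gives the boundedness
   that Fubini requires. *)
have uM p : disc (0, 0) rho p -> normc (u p) <= (1 - rho) ^- 2 * L.
  move=> pr; have : D p by apply: disc_sub_unit_disc pr; rewrite rho0 ltW.
  move=> /unit_disc_polar[r [t [r01 pE]]].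
  have [r0 r1] := andP r01.
  have rr : r < rho by apply/(disc0_polar t rho0 r0); rewrite -pE.
  rewrite pE; have := ub r t r01; rewrite LE -EFinM lee_fin => /le_trans; apply.
  apply: ler_wpM2r => //; rewrite lef_pV2 ?posrE ?exprn_gt0 ?subr_gt0//.
  by rewrite ler_sqr ?nnegrE; lra.
have ReM p : disc (0, 0) rho p -> `|complex.Re (u p)| <= (1 - rho) ^- 2 * L.
  by move=> /uM; apply: le_trans; exact: normr_Re_le_normc.
have ImM p : disc (0, 0) rho p -> `|complex.Im (u p)| <= (1 - rho) ^- 2 * L.
  by move=> /uM; apply: le_trans; exact: normr_Im_le_normc.
have p2 : 0 < 2 * pi :> R by rewrite mulr_gt0// pi_gt0.
have I0 (c : R) : \int[m1]_(t in `[0, 2 * pi]) c = 2 * pi * c.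
  rewrite Rintegral_cst//= lebesgue_measure_itv/= lte_fin p2 /=.
  by rewrite subr0 mulrC.
have polar0 t : polar 0 t = (0, 0) :> R * R by rewrite /polar !mul0r.
(* The comparison is with radius 0, where the circle degenerates to the origin and the mean is
   [u (0, 0)]. *)
have cmE r : 0 <= r < 1 ->
    \int[m1]_(t in `[0, 2 * pi]) complex.Re (u (polar r t)) = 2 * pi * complex.Re (u (0, 0)) /\
    \int[m1]_(t in `[0, 2 * pi]) complex.Im (u (polar r t)) = 2 * pi * complex.Im (u (0, 0)).
  move=> r01; have := cm r 0 r01; rewrite lexx ltr01 => /(_ isT).
  rewrite /circle_mean => /mulfI H.
  have /H[] : ((2 * pi)^-1)%:C%C != 0 :> R[i].
    by rewrite -[0]/(0%:C%C) (inj_eq (@complexI _)) invr_eq0 gt_eqF.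
  by move=> -> ->; split; under eq_Rintegral do rewrite polar0; rewrite I0.
have mB : measurable (disc (0, 0) rho : set (mR * mR)) by exact: measurable_disc.
have BD : disc (0, 0) rho `<=` D by apply: disc_sub_unit_disc; rewrite rho0 ltW.
have Bfin : (m2 (disc (0%R, 0%R) rho) < +oo)%E by rewrite area_disc// ltry.
have mRe := measurable_Re uL; have mIm := measurable_Im uL.
split; apply: Rintegral_area_disc_mean => //.
- apply: (bounded_integrable mB Bfin _ ReM).
  by apply: measurable_funS mRe => //; exact: measurable_unit_disc.
- by apply: (disc_mean_of_circle_mean rho01 mRe ReM) => r /cmE[].
- apply: (bounded_integrable mB Bfin _ ImM).
  by apply: measurable_funS mIm => //; exact: measurable_unit_disc.
- by apply: (disc_mean_of_circle_mean rho01 mIm ImM) => r /cmE[].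
Qed.

(** * Disc means of harmonic functions *)

(** The product sigma-algebra is generated by rectangles, not by open sets, so [O] is written as a
    countable union of boxes with rational centers. Boxes not contained in [O] are replaced by the
    empty set, which keeps the index set simple. *)
Lemma open_plane_measurable (O : set (R * R)) : open O ->
  measurable (O : set (mR * mR)).
Proof.
move=> oO.
pose box (q1 q2 : rat) (n : nat) : set (R * R) :=
  ball (ratr q1 : R) n.+1%:R^-1 `*` ball (ratr q2 : R) n.+1%:R^-1.
pose F q1 q2 n : set (R * R) := if `[< box q1 q2 n `<=` O >] then box q1 q2 n else set0.
have -> : O = \bigcup_q1 \bigcup_q2 \bigcup_n F q1 q2 n.
  apply/seteqP; split => [[x y] Oxy|p [q1 _ [q2 _ [n _]]]]; last first.
    by rewrite /F; case: asboolP => // H /H.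
  have /nbhs_ballP[e /= e0 eO] : nbhs (x, y) O by exact: open_nbhs_nbhs.
  (* A box of radius 1 / (n + 1) containing the point stays within twice that radius of it, hence
     inside the ball of radius [e]. *)
  pose n := Num.truncn (2 / e).
  have n0 : 0 < n.+1%:R^-1 :> R by rewrite invr_gt0.
  have ne : 2 * n.+1%:R^-1 < e.
    by rewrite ltr_pdivrMr// mulrC -ltr_pdivrMr//; exact: truncnS_gt.
  set r : R := n.+1%:R^-1 in n0 ne.
  have [q1 Hq1] : exists q : rat, ball (ratr q : R) r x.
    have /rat_in_itvoo[q] : x - r < x + r by lra.
    by rewrite in_itv/= => /andP[h1 h2]; exists q;
      rewrite -ball_normE /= ltr_norml; apply/andP; split; lra.
  have [q2 Hq2] : exists q : rat, ball (ratr q : R) r y.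
    have /rat_in_itvoo[q] : y - r < y + r by lra.
    by rewrite in_itv/= => /andP[h1 h2]; exists q;
      rewrite -ball_normE /= ltr_norml; apply/andP; split; lra.
  have sub : box q1 q2 n `<=` O.
    move=> [x' y'] [/= H1 H2]; apply: eO; split => /=.
      apply: le_ball (ball_triangle (ball_sym Hq1) H1).
      by rewrite -mulr2n -mulr_natl ltW.
    apply: le_ball (ball_triangle (ball_sym Hq2) H2).
    by rewrite -mulr2n -mulr_natl ltW.
  by exists q1 => //; exists q2 => //; exists n => //; rewrite /F; case: asboolP.
apply: bigcupT_measurable_rat => q1; apply: bigcupT_measurable_rat => q2.
apply: bigcupT_measurable => n; rewrite /F; case: asboolP => // _.
by apply: measurableX; exact: measurable_ball.
Qed.

Lemma continuous_sqnorm (a b : R) :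
  continuous (fun p : R * R => (p.1 - a) ^+ 2 + (p.2 - b) ^+ 2).
Proof.
move=> p; apply: cvgD.
  rewrite (_ : (fun p : R * R => _) = (fun p : R * R => (p.1 - a) * (p.1 - a))).
    by rewrite expr2; apply: cvgM; apply: cvgB; (exact: cvg_fst || exact: cvg_cst).
  by apply/funext => q; rewrite expr2.
rewrite (_ : (fun p : R * R => _) = (fun p : R * R => (p.2 - b) * (p.2 - b))).
  by rewrite expr2; apply: cvgM; apply: cvgB; (exact: cvg_snd || exact: cvg_cst).
by apply/funext => q; rewrite expr2.
Qed.

Lemma open_unit_disc : open D.
Proof.
rewrite unit_discE /disc.
apply: (@open_comp _ _
  (fun p : R * R => (p.1 - 0) ^+ 2 + (p.2 - 0) ^+ 2) [set x | x < 1 ^+ 2]).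
  by move=> p _; exact: continuous_sqnorm.
exact: open_lt.
Qed.

Lemma continuous_disc_measurable (f : R * R -> R) :
  (forall p, D p -> {for p, continuous f}) -> measurable_fun (D : set (mR * mR)) f.
Proof.
move=> cf _; apply: (measurability _ (RGenOInfty.measurableE R)).
move=> /= _ [_ [a ->]] <-; apply: open_plane_measurable.
rewrite openE => p [Dp /= fp]; apply: filterI.
  exact: open_nbhs_nbhs (conj open_unit_disc Dp).
by apply: cf => //; exact: open_nbhs_nbhs (conj (@interval_open _ _ _ _ _) fp).
exact: measurable_unit_disc.
Qed.

(** Closed discs supply compactness, hence bounds for continuous functions, and contain the
    endpoints of the chords on which one integrates by parts. *)
Definition closed_disc (c : R * R) (d : R) : set (R * R) :=
  [set p | (p.1 - c.1) ^+ 2 + (p.2 - c.2) ^+ 2 <= d ^+ 2].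

Lemma closed_disc_le (c p : R * R) (d : R) : 0 <= d -> closed_disc c d p ->
  `|p.1 - c.1| <= d /\ `|p.2 - c.2| <= d.
Proof.
move=> d0 H; split; rewrite -(ger0_norm d0) -ler_sqr ?nnegrE// !real_normK ?num_real//.
  by apply: le_trans H; rewrite lerDl sqr_ge0.
by apply: le_trans H; rewrite lerDr sqr_ge0.
Qed.

Lemma compact_closed_disc (c : R * R) (d : R) : 0 <= d -> compact (closed_disc c d).
Proof.
move=> d0; apply: (@subclosed_compact _ _
  (`[c.1 - d, c.1 + d]%classic `*` `[c.2 - d, c.2 + d]%classic)).
- apply: (@preimage_closed _ _
    (fun p : R * R => (p.1 - c.1) ^+ 2 + (p.2 - c.2) ^+ 2) [set x | x <= d ^+ 2]).
    by move=> p _; exact: continuous_sqnorm.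
  exact: closed_le.
- by apply: compact_setX; exact: segment_compact.
- move=> p /(closed_disc_le d0)[]; rewrite !ler_norml => /andP[? ?] /andP[? ?].
  by split; rewrite /= in_itv/=; apply/andP; split; lra.
Qed.

Lemma continuous_closed_disc_bounded (f : R * R -> R) (c : R * R) (d : R) : 0 <= d ->
  (forall p, closed_disc c d p -> {for p, continuous f}) ->
  exists M, forall p, closed_disc c d p -> `|f p| <= M.
Proof.
move=> d0 cf.
have wf : {within closed_disc c d, continuous f}.
  by apply: continuous_in_subspaceT => p /set_mem; exact: cf.
have /compact_bounded[M [_ HM]] := continuous_compact wf (compact_closed_disc (c := c) d0).
exists (M + 1) => p Hp; apply: HM; first by rewrite ltrDl.
by exists p.
Qed.

(** * Differentiation along lines *)

Lemma is_derive_partial1 (f : R * R -> R) (x y : R) : derivable f (x, y) (dirx R) ->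
  is_derive x 1 (fun t => f (t, y)) ('D_(dirx R) f (x, y)).
Proof.
move=> df.
have E : (fun h : R => h^-1 *: (((fun t => f (t, y)) \o shift x) (h *: (1 : R)) - f (x, y))) =
   (fun h => h^-1 *: ((f \o shift (x, y)) (h *: dirx R) - f (x, y))).
  apply/funext => h; rewrite /dirx /= /shift /=.
  rewrite /GRing.add/= /add_pair /= /GRing.scale /= mulr0 add0r //.
split; first by rewrite /derivable E.
by rewrite /derive E.
Qed.

Lemma is_derive_partial2 (f : R * R -> R) (x y : R) : derivable f (x, y) (diry R) ->
  is_derive y 1 (fun t => f (x, t)) ('D_(diry R) f (x, y)).
Proof.
move=> df.
have E : (fun h : R => h^-1 *: (((fun t => f (x, t)) \o shift y) (h *: (1 : R)) - f (x, y))) =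
   (fun h => h^-1 *: ((f \o shift (x, y)) (h *: diry R) - f (x, y))).
  apply/funext => h; rewrite /diry /= /shift /=.
  rewrite /GRing.add/= /add_pair /= /GRing.scale /= mulr0 add0r //.
split; first by rewrite /derivable E.
by rewrite /derive E.
Qed.

Lemma MVT_increment (g dg : R -> R) (x h : R) :
  (forall t, `|t - x| <= `|h| -> is_derive t 1 g (dg t)) ->
  exists2 xi, `|xi - x| <= `|h| & g (x + h) - g x = dg xi * h.
Proof.
move=> dG.
have key (a b : R) : a <= b -> (forall t, a <= t <= b -> `|t - x| <= `|h|) ->
    exists2 xi, `|xi - x| <= `|h| & g b - g a = dg xi * (b - a).
  move=> ab abh.
  have dab t : t \in `]a, b[ -> is_derive t 1 g (dg t).
    by rewrite in_itv/= => /andP[at_ tb]; apply: dG; apply: abh; rewrite !ltW.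
  have cab : {within `[a, b], continuous g}.
    apply: continuous_in_subspaceT => t /set_mem; rewrite /= in_itv/= => tab.
    have [? _] := dG _ (abh _ tab).
    exact/differentiable_continuous/derivable1_diffP.
  have [xi xiI E] := MVT_segment ab dab cab.
  by exists xi => //; apply: abh; move: xiI; rewrite in_itv.
have [h0|h0] := leP 0 h.
  have [||xi xih E] := key x (x + h); first by rewrite lerDl.
    by move=> t /andP[t1 t2]; rewrite !ger0_norm; lra.
  by exists xi => //; rewrite E; ring.
have [||xi xih E] := key (x + h) x; first by rewrite gerDl ltW.
  by move=> t /andP[t1 t2]; rewrite ler0_norm ?ltr0_norm; lra.
by exists xi => //; rewrite -opprB E; ring.
Qed.

Lemma is_derive1_cvgP (g : R -> R) (x l : R) :
  is_derive x 1 g l <-> (h^-1 * (g (h + x) - g x)) @[h --> 0^'] --> l.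
Proof.
have E : (fun h : R => h^-1 * (g (h + x) - g x)) =
    (fun h => h^-1 *: ((g \o shift x) (h *: (1 : R)) - g x)).
  by apply/funext => h; rewrite /= /GRing.scale/= mulr1.
rewrite E; split=> [[dg <-]|H]; first exact: dg.
by split; [apply/cvg_ex; exists l|apply: cvg_lim].
Qed.

(** The increment is split into a vertical step from [p], covered by the chain rule in one variable,
    and a horizontal step at the moved height. The mean value theorem turns the latter into a value
    of the first partial derivative near [p], which is close to its value at [p] by continuity. *)
Lemma is_derive_line (f : R * R -> R) (a b v w s : R) :
  let p := (a + s * v, b + s * w) in
  (\forall q \near p, derivable f q (dirx R)) ->
  (\forall q \near p, derivable f q (diry R)) ->
  {for p, continuous ('D_(dirx R) f)} ->
  is_derive s 1 (fun s => f (a + s * v, b + s * w))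
    ('D_(dirx R) f p * v + 'D_(diry R) f p * w).
Proof.
move=> p nx ny cx.
set L := _ + _.
have pE : p = (a + s * v, b + s * w) by [].
have Ly : is_derive s 1 (fun s' => f (a + s * v, b + s' * w)) ('D_(diry R) f p * w).
  have dy := is_derive_partial2 (nbhs_singleton ny).
  have dl : is_derive s 1 (fun s : R => b + s * w) w.
    apply: is_derive_eq; rewrite /GRing.scale/=; ring.
  exact: (@is_derive1_comp R (fun t => f (a + s * v, t)) (fun s : R => b + s * w) s _ _ dy dl).
apply/is_derive1_cvgP; move/is_derive1_cvgP : Ly => Hy; rewrite -pE in Hy *.
suff Hx : (fun h : R => h^-1 * (f (a + (h + s) * v, b + (h + s) * w) -
    f (a + s * v, b + (h + s) * w))) @ 0^' --> 'D_(dirx R) f p * v.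
  have -> : (fun h : R => h^-1 * (f (a + (h + s) * v, b + (h + s) * w) - f p)) =
      (fun h => h^-1 * (f (a + (h + s) * v, b + (h + s) * w) - f (a + s * v, b + (h + s) * w))
        + h^-1 * (f (a + s * v, b + (h + s) * w) - f p)).
    by apply/funext => h; rewrite -mulrDr addrA subrK.
  exact: cvgD Hx Hy.
apply/cvgrPdist_le => e e0.
(* Adding 1 keeps the denominator positive when [v = 0]. *)
pose e' := e / (`|v| + 1).
have v1 : 0 < `|v| + 1 by rewrite ltr_wpDl.
have e'0 : 0 < e' by rewrite divr_gt0.
have : \forall q \near p, `|'D_(dirx R) f p - 'D_(dirx R) f q| <= e' /\ derivable f q (dirx R).
  by apply: filterI; [move/cvgrPdist_le : cx; exact|exact: nx].
move=> /nbhs_ballP[r /= r0 Hr].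
have small (z : R) : \forall h \near 0^', `|h * z| < r.
  have z1 : 0 < `|z| + 1 by rewrite ltr_wpDl.
  near=> h; rewrite normrM.
  have : `|h| < r / (`|z| + 1) by near: h; apply: dnbhs0_lt; rewrite divr_gt0.
  rewrite ltr_pdivlMr//; apply: le_lt_trans.
  by apply: ler_wpM2l => //; rewrite lerDl.
near=> h.
have hv : `|h * v| < r by near: h; exact: small.
have hw : `|h * w| < r by near: h; exact: small.
have h0 : h != 0 by near: h; exact: nbhs_dnbhs_neq.
have [|xi xih E] := @MVT_increment (fun t => f (t, b + (h + s) * w))
  (fun t => 'D_(dirx R) f (t, b + (h + s) * w)) (a + s * v) (h * v).
  move=> t th; apply: is_derive_partial1.
  apply: (Hr (t, _) _).2; split => /=; rewrite -ball_normE /=.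
    by rewrite distrC (le_lt_trans th).
  by rewrite (_ : _ - _ = - (h * w)) ?normrN//; ring.
have -> : f (a + (h + s) * v, b + (h + s) * w) = f (a + s * v + h * v, b + (h + s) * w).
  by congr (f (_, _)); ring.
rewrite E.
have -> : 'D_(dirx R) f p * v - h^-1 * ('D_(dirx R) f (xi, b + (h + s) * w) * (h * v)) =
  ('D_(dirx R) f p - 'D_(dirx R) f (xi, b + (h + s) * w)) * v by field.
rewrite normrM.
apply: (@le_trans _ _ (e' * `|v|)).
  apply: ler_wpM2r => //; apply: (Hr (xi, _) _).1; split => /=; rewrite -ball_normE /=.
    by rewrite distrC (le_lt_trans xih).
  by rewrite (_ : _ - _ = - (h * w)) ?normrN//; ring.
rewrite /e' mulrAC ler_pdivrMr// ler_pM2l//; lra.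
Unshelve. all: by end_near.
Qed.

(** * Integration by parts on discs *)

Lemma is_derive1_continuous (g : R -> R) (x l : R) :
  is_derive x 1 g l -> {for x, continuous g}.
Proof. by move=> [dg _]; exact/differentiable_continuous/derivable1_diffP. Qed.

(* [(c^2 - (x - a)^2) / 2] is minus the primitive of [x - a] vanishing at both
   endpoints. *)
Lemma ibp_interval (g dg : R -> R) (a c : R) : 0 <= c ->
  (forall x, `|x - a| <= c -> is_derive x 1 g (dg x)) ->
  (forall x, `|x - a| <= c -> {for x, continuous dg}) ->
  \int[m1]_(x in `](a - c), (a + c)[) (g x * (x - a)) =
  \int[m1]_(x in `](a - c), (a + c)[) (dg x * ((c ^+ 2 - (x - a) ^+ 2) / 2)).
Proof.
rewrite le_eqVlt => /predU1P[<- _ _|c0 dG cdg].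
  by rewrite !subr0 !addr0 !set_itvoo0 !Rintegral_set0.
have acc : a - c < a + c by lra.
have inI x : x \in `[a - c, a + c] -> `|x - a| <= c.
  by rewrite in_itv/= ler_distl.
have inJ x : x \in `]a - c, a + c[ -> `|x - a| <= c.
  by rewrite in_itv/= => /andP[h1 h2]; rewrite ler_distl !ltW.
have inl : `|a - c - a| <= c by rewrite addrAC subrr add0r normrN gtr0_norm.
have inr : `|a + c - a| <= c by rewrite addrAC subrr add0r gtr0_norm.
have cg x : `|x - a| <= c -> {for x, continuous g} by move=> /dG; exact: is_derive1_continuous.
pose G (x : R) : R := ((x - a) ^+ 2 - c ^+ 2) / 2.
have dGx (x : R) : is_derive x 1 G (x - a).
  by rewrite /G; apply: is_derive_eq; rewrite /GRing.scale/=; field.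
have cG (x : R) : {for x, continuous G} := is_derive1_continuous (dGx x).
have cid (x : R) : {for x, continuous (fun x : R => x - a)}.
  by apply: cvgB; [exact: cvg_id|exact: cvg_cst].
have wi (h : R -> R) : (forall x, `|x - a| <= c -> {for x, continuous h}) ->
    m1.-integrable `[(a - c), (a + c)] (EFin \o h).
  move=> ch; apply: continuous_compact_integrable; first exact: segment_compact.
  by apply: continuous_in_subspaceT => x /set_mem/inI; exact: ch.
have oc (h : R -> R) : (forall x, `|x - a| <= c -> {for x, continuous h}) ->
    \int[m1]_(x in `](a - c), (a + c)[) h x = \int[m1]_(x in `[(a - c), (a + c)]) h x.
  move=> /wi hi; rewrite Rintegral_itv_bndo_bndc ?Rintegral_itv_obnd_cbnd//.
    by apply: integrableS hi => //; exact: subset_itv_oc_cc.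
  by apply: integrableS hi => //; exact: subset_itv_oo_cc.
rewrite oc; last by move=> x xc; apply: continuousM; [exact: cg|exact: cid].
rewrite oc; last first.
  move=> x xc; apply: continuousM; first exact: cdg.
  rewrite (_ : (fun x => _) = (fun x => - G x)); first by apply: continuousN; exact: cG.
  by apply/funext => y; rewrite /G; ring.
rewrite (@Rintegration_by_parts R g G dg (fun x => x - a))//.
- have -> : g (a + c) * G (a + c) - g (a - c) * G (a - c) = 0 by rewrite /G; ring.
  rewrite sub0r -mulN1r -RintegralZl//; last first.
    by apply: wi => x xc; apply: continuousM; [exact: cdg|exact: cG].
  by apply: eq_Rintegral => x _; rewrite /G; ring.
- by apply: continuous_in_subspaceT => x /set_mem/inI; exact: cdg.
- split.
  + by move=> x /inJ/dG[].
  + by apply: cvg_at_right_filter; exact: cg.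
  + by apply: cvg_at_left_filter; exact: cg.
- by move=> x /inJ/dG dx; rewrite derive1E derive_val.
- by apply: continuous_in_subspaceT => x _; exact: cid.
- split.
  + by move=> x _; have [] := dGx x.
  + by apply: cvg_at_right_filter; exact: cG.
  + by apply: cvg_at_left_filter; exact: cG.
- by move=> x _; have dx := dGx x; rewrite derive1E derive_val.
Qed.

Section disc.
Variables (c : R * R) (d M : R) (g dg : R * R -> R).
Hypotheses (d0 : 0 < d).
Hypotheses (mg : measurable_fun (disc c d : set (mR * mR)) g)
  (mdg : measurable_fun (disc c d : set (mR * mR)) dg).
Hypotheses (gM : forall p, disc c d p -> `|g p| <= M)
  (dgM : forall p, disc c d p -> `|dg p| <= M).

Let phi (p : R * R) := (d ^+ 2 - ((p.1 - c.1) ^+ 2 + (p.2 - c.2) ^+ 2)) / 2.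

Lemma disc_sub_closed : disc c d `<=` closed_disc c d.
Proof. by move=> p; exact: ltW. Qed.

Let mE : measurable (disc c d : set (mR * mR)). Proof. exact: measurable_disc. Qed.
Let A : set mR := `[c.1 - d, c.1 + d]%classic.
Let B : set mR := `[c.2 - d, c.2 + d]%classic.
Let mA : measurable A. Proof. exact: measurable_itv. Qed.
Let mB : measurable B. Proof. exact: measurable_itv. Qed.
Let Afin : (m1 A < +oo)%E.
Proof. exact: lebesgue_measure_segment_fin. Qed.
Let Bfin : (m1 B < +oo)%E.
Proof. exact: lebesgue_measure_segment_fin. Qed.
Let EAB : disc c d `<=` A `*` B.
Proof.
move=> p /disc_sub_closed/(closed_disc_le (ltW d0))[]; rewrite !ler_distl.
by rewrite /A /B /= !in_itv/=.
Qed.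

Let mphi : measurable_fun (disc c d : set (mR * mR)) phi.
Proof.
apply: measurable_funM => //; apply: measurable_funB => //.
by apply: measurable_funD; apply: measurable_funX; apply: measurable_funB => //;
  exact: measurable_funTS.
Qed.

Let phiM p : disc c d p -> `|phi p| <= d ^+ 2.
Proof.
rewrite /disc /= => pd; have n0 : 0 <= (p.1 - c.1) ^+ 2 + (p.2 - c.2) ^+ 2.
  by rewrite addr_ge0 ?sqr_ge0.
by rewrite /phi ger0_norm; have := sqr_ge0 d; lra.
Qed.

Let M0 : 0 <= M.
Proof.
apply: le_trans (gM (_ : disc c d c)); first exact: normr_ge0.
by rewrite /disc /= !subrr expr0n /= addr0 exprn_gt0.
Qed.

Let dphiM p : disc c d p -> `|dg p * phi p| <= M * d ^+ 2.
Proof. by move=> pd; rewrite normrM ler_pM// ?dgM// phiM. Qed.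

Let mdphi : measurable_fun (disc c d : set (mR * mR)) (fun p => dg p * phi p).
Proof. exact: measurable_funM. Qed.

(** On the horizontal chord at height [y], of half-length r with r^2 = d^2 - (y - c.2)^2, [phi] is
    exactly the weight (r^2 - (x - c.1)^2) / 2 of [ibp_interval]. It is the same function on
    vertical chords, so the two lemmas can be added. *)
Lemma ibp_disc1 :
  (forall p, closed_disc c d p -> is_derive p.1 1 (fun t => g (t, p.2)) (dg p)) ->
  (forall p, closed_disc c d p -> {for p.1, continuous (fun t => dg (t, p.2))}) ->
  \int[m2]_(p in disc c d) (g p * (p.1 - c.1)) =
  \int[m2]_(p in disc c d) (dg p * phi p).
Proof.
move=> ddg cdg.
have gxM p : disc c d p -> `|g p * (p.1 - c.1)| <= M * d.
  move=> pd; rewrite normrM ler_pM// ?gM//.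
  by have [] := closed_disc_le (ltW d0) (disc_sub_closed pd).
have mgx : measurable_fun (disc c d : set (mR * mR)) (fun p => g p * (p.1 - c.1)).
  apply: measurable_funM => //; apply: measurable_funB => //; exact: measurable_funTS.
rewrite (Rintegral_prod21 mA mB mE Afin Bfin EAB mgx gxM).
rewrite (Rintegral_prod21 mA mB mE Afin Bfin EAB mdphi dphiM).
apply: eq_Rintegral => y /set_mem yB.
rewrite ysection_disc ?ltW//; set r := Num.sqrt _.
have r2 : r ^+ 2 = d ^+ 2 - (y - c.2) ^+ 2.
  have yd : `|y - c.2| <= d by move: yB; rewrite /B /= in_itv/= ler_distl.
  rewrite sqr_sqrtr// subr_ge0 -[leLHS]real_normK ?num_real//.
  by rewrite ler_sqr ?nnegrE// ltW.
have incl x : `|x - c.1| <= r -> closed_disc c d (x, y).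
  move=> xr; rewrite /closed_disc /= -lerBrDr -r2 -[leLHS]real_normK ?num_real//.
  by rewrite ler_sqr ?nnegrE// sqrtr_ge0.
have H1 t : `|t - c.1| <= r ->
    is_derive t 1 (fun x => g (x, y)) (dg (t, y)).
  by move=> /incl/ddg.
have H2 t : `|t - c.1| <= r -> {for t, continuous (fun x => dg (x, y))}.
  by move=> /incl/cdg.
rewrite (ibp_interval (sqrtr_ge0 _ : 0 <= r) H1 H2).
by apply: eq_Rintegral => t _; rewrite /phi/= r2; congr (_ * (_ / _)); ring.
Qed.

Lemma ibp_disc2 :
  (forall p, closed_disc c d p -> is_derive p.2 1 (fun t => g (p.1, t)) (dg p)) ->
  (forall p, closed_disc c d p -> {for p.2, continuous (fun t => dg (p.1, t))}) ->
  \int[m2]_(p in disc c d) (g p * (p.2 - c.2)) =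
  \int[m2]_(p in disc c d) (dg p * phi p).
Proof.
move=> ddg cdg.
have gxM p : disc c d p -> `|g p * (p.2 - c.2)| <= M * d.
  move=> pd; rewrite normrM ler_pM// ?gM//.
  by have [] := closed_disc_le (ltW d0) (disc_sub_closed pd).
have mgx : measurable_fun (disc c d : set (mR * mR)) (fun p => g p * (p.2 - c.2)).
  apply: measurable_funM => //; apply: measurable_funB => //; exact: measurable_funTS.
rewrite (Rintegral_prod12 mA mB mE Afin Bfin EAB mgx gxM).
rewrite (Rintegral_prod12 mA mB mE Afin Bfin EAB mdphi dphiM).
apply: eq_Rintegral => x /set_mem xA.
rewrite xsection_disc ?ltW//; set r := Num.sqrt _.
have r2 : r ^+ 2 = d ^+ 2 - (x - c.1) ^+ 2.
  have yd : `|x - c.1| <= d by move: xA; rewrite /A /= in_itv/= ler_distl.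
  rewrite sqr_sqrtr// subr_ge0 -[leLHS]real_normK ?num_real//.
  by rewrite ler_sqr ?nnegrE// ltW.
have incl y : `|y - c.2| <= r -> closed_disc c d (x, y).
  move=> yr; rewrite /closed_disc /= addrC -lerBrDr -r2 -[leLHS]real_normK ?num_real//.
  by rewrite ler_sqr ?nnegrE// sqrtr_ge0.
have H1 t : `|t - c.2| <= r ->
    is_derive t 1 (fun y => g (x, y)) (dg (x, t)).
  by move=> /incl/ddg.
have H2 t : `|t - c.2| <= r -> {for t, continuous (fun y => dg (x, y))}.
  by move=> /incl/cdg.
rewrite (ibp_interval (sqrtr_ge0 _ : 0 <= r) H1 H2).
by apply: eq_Rintegral => t _; rewrite /phi/= r2; congr (_ * (_ / _)); ring.
Qed.

End disc.

(** * The mean value property over discs *)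

Definition ray (c p : R * R) (s : R) : R * R :=
  (c.1 + s * (p.1 - c.1), c.2 + s * (p.2 - c.2)).

Lemma ray_closed_disc c d p s : 0 <= s <= 1 -> closed_disc c d p ->
  closed_disc c d (ray c p s).
Proof.
move=> /andP[s0 s1]; rewrite /closed_disc /ray /=; apply: le_trans.
have n0 : 0 <= (p.1 - c.1) ^+ 2 + (p.2 - c.2) ^+ 2 by rewrite addr_ge0 ?sqr_ge0.
rewrite (_ : _ + _ = s ^+ 2 * ((p.1 - c.1) ^+ 2 + (p.2 - c.2) ^+ 2)); last by ring.
by rewrite ler_piMl// expr_le1.
Qed.

Lemma measurable_ray c :
  measurable_fun [set: (mR * mR) * mR] (fun z => ray c z.1 z.2 : mR * mR).
Proof.
have m11 : measurable_fun [set: (mR * mR) * mR] (fun z => z.1.1 : mR).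
  exact: measurableT_comp.
have m12 : measurable_fun [set: (mR * mR) * mR] (fun z => z.1.2 : mR).
  exact: measurableT_comp.
apply: measurable_fun_pair; apply: measurable_funD => //; apply: measurable_funM => //;
  exact: measurable_funB.
Qed.

Lemma continuous_pair (T : topologicalType) (g h : T -> R) (x : T) :
  {for x, continuous g} -> {for x, continuous h} ->
  {for x, continuous (fun y => (g y, h y))}.
Proof. by move=> cg ch; apply: (cvg_pair cg ch). Qed.

Lemma continuous_affine (a v s : R) : {for s, continuous (fun s : R => a + s * v)}.
Proof.
apply: continuousD; first exact: cst_continuous.
by apply: continuousM; [exact: cvg_id|exact: cst_continuous].
Qed.

Lemma continuous_ray c p s : {for s, continuous (ray c p : R -> R * R)}.
Proof. by apply: continuous_pair; exact: continuous_affine. Qed.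

Section harmonic.
Variables (f : R * R -> R) (c : R * R) (d : R).
Hypotheses (d0 : 0 < d) (cD : closed_disc c d `<=` D).
Hypothesis hf : harmonic_disc f.

Let fx := 'D_(dirx R) f.
Let fy := 'D_(diry R) f.
Let fxx := 'D_(dirx R) fx.
Let fyy := 'D_(diry R) fy.

Let xin : dirx R \in [:: dirx R; diry R]. Proof. by rewrite inE eqxx. Qed.
Let yin : diry R \in [:: dirx R; diry R]. Proof. by rewrite !inE eqxx orbT. Qed.

Let C2 : C2_disc f. Proof. by case: hf. Qed.

Let cf p : D p -> {for p, continuous f}. Proof. by case/C2. Qed.
Let dfx p : D p -> derivable f p (dirx R).
Proof. by case/C2 => _ /(_ _ xin)[]. Qed.
Let dfy p : D p -> derivable f p (diry R).
Proof. by case/C2 => _ /(_ _ yin)[]. Qed.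
Let cfx p : D p -> {for p, continuous fx}.
Proof. by case/C2 => _ /(_ _ xin)[]. Qed.
Let cfy p : D p -> {for p, continuous fy}.
Proof. by case/C2 => _ /(_ _ yin)[]. Qed.
Let dfxx p : D p -> derivable fx p (dirx R).
Proof. by case/C2 => _ /(_ _ xin)[_ _ /(_ _ xin)[]]. Qed.
Let dfyy p : D p -> derivable fy p (diry R).
Proof. by case/C2 => _ /(_ _ yin)[_ _ /(_ _ yin)[]]. Qed.
Let cfxx p : D p -> {for p, continuous fxx}.
Proof. by case/C2 => _ /(_ _ xin)[_ _ /(_ _ xin)[]]. Qed.
Let cfyy p : D p -> {for p, continuous fyy}.
Proof. by case/C2 => _ /(_ _ yin)[_ _ /(_ _ yin)[]]. Qed.

Let E := disc c d.
Let I : set mR := `[0, 1]%classic.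
Let mE : measurable (E : set (mR * mR)). Proof. exact: measurable_disc. Qed.
Let mI : measurable I. Proof. exact: measurable_itv. Qed.
Let Efin : (m2 E < +oo)%E. Proof. by rewrite area_disc// ltry. Qed.
Let Ifin : (m1 I < +oo)%E.
Proof. exact: lebesgue_measure_segment_fin. Qed.

Let rayD p s : 0 <= s <= 1 -> closed_disc c d p -> D (ray c p s).
Proof. by move=> s01 pd; apply/cD/ray_closed_disc. Qed.

(** [g] is controlled only on the unit disc. Its extension by 0 is measurable on the plane and
    agrees with it along these rays, which stay in the unit disc. *)
Lemma measurable_along_ray (g : R * R -> R) :
  (forall p, D p -> {for p, continuous g}) ->
  measurable_fun (E `*` I) (fun z : (mR * mR) * mR => g (ray c z.1 z.2)).
Proof.
move=> /continuous_disc_measurable mg.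
have mD := @measurable_unit_disc.
have mgD : measurable_fun [set: mR * mR] (g \_ D) by exact/(measurable_restrictT _ mD).
have : measurable_fun (E `*` I) (fun z : (mR * mR) * mR => (g \_ D) (ray c z.1 z.2)).
  by apply: measurable_funTS; apply: measurableT_comp => //; exact: measurable_ray.
apply: eq_measurable_fun => -[p s] /set_mem[/= Ep Is].
rewrite patchE mem_set//; apply: rayD; last exact: disc_sub_closed.
by move: Is; rewrite /I /= in_itv.
Qed.

Lemma measurable_at_ray (g : R * R -> R) (s : R) : 0 <= s <= 1 ->
  (forall p, D p -> {for p, continuous g}) ->
  measurable_fun (E : set (mR * mR)) (fun p : mR * mR => g (ray c p s)).
Proof.
move=> s01 cg.
apply: (measurable_comp (measurableX mE mI) _ (measurable_along_ray cg)
  (g := fun p : mR * mR => (p, s : mR))) => //.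
  by move=> _ [p Ep <-]; split => //=; rewrite /I /= in_itv.
by apply: measurable_funTS; exact: pair2_measurable.
Qed.

Lemma bounded_along_ray (g : R * R -> R) :
  (forall p, D p -> {for p, continuous g}) ->
  exists M, forall p s, 0 <= s <= 1 -> closed_disc c d p -> `|g (ray c p s)| <= M.
Proof.
move=> cg; have [|M HM] := @continuous_closed_disc_bounded g c d (ltW d0).
  by move=> p /cD; exact: cg.
by exists M => p s s01 pd; apply: HM; exact: ray_closed_disc.
Qed.

(** The derivative of [f (ray c p s)] with respect to [s]. *)
Let radial (p : R * R) (s : R) : R :=
  fx (ray c p s) * (p.1 - c.1) + fy (ray c p s) * (p.2 - c.2).

(** Differentiating [fx] and [fy] along [ray] in the coordinates of [p] brings out the same factor
    [s], so the two integrations by parts add up to [s] times the Laplacian against [phi]. *)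
Lemma radial_flux0 (s : R) : 0 <= s <= 1 ->
  \int[m2]_(p in E) radial p s = 0.
Proof.
move=> s01.
have [Mx HMx] := bounded_along_ray cfx.
have [My HMy] := bounded_along_ray cfy.
have [Mxx HMxx] := bounded_along_ray cfxx.
have [Myy HMyy] := bounded_along_ray cfyy.
have [s0 s1] := andP s01.
have leD p : E p -> `|p.1 - c.1| <= d /\ `|p.2 - c.2| <= d.
  by move/disc_sub_closed/(closed_disc_le (ltW d0)).
have M0 (g : R * R -> R) M :
    (forall p s, 0 <= s <= 1 -> closed_disc c d p -> `|g (ray c p s)| <= M) -> 0 <= M.
  move=> H; apply: le_trans (normr_ge0 _) (H c 0 _ _); first by rewrite lexx ler01.
  by rewrite /closed_disc /= !subrr expr0n /= addr0 sqr_ge0.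
have sM (g : R * R -> R) M p :
    (forall p s, 0 <= s <= 1 -> closed_disc c d p -> `|g (ray c p s)| <= M) ->
    E p -> `|g (ray c p s) * s| <= M.
  move=> H /disc_sub_closed pd; rewrite normrM (ger0_norm s0).
  by apply: le_trans (H p s s01 pd); rewrite ler_piMr.
have mc1 : measurable_fun (E : set (mR * mR)) (fun p : mR * mR => p.1 - c.1).
  by apply: measurable_funB => //; exact: measurable_funTS.
have mc2 : measurable_fun (E : set (mR * mR)) (fun p : mR * mR => p.2 - c.2).
  by apply: measurable_funB => //; exact: measurable_funTS.
pose phi (p : R * R) := (d ^+ 2 - ((p.1 - c.1) ^+ 2 + (p.2 - c.2) ^+ 2)) / 2.
have mphi : measurable_fun (E : set (mR * mR)) phi.
  apply: measurable_funM => //; apply: measurable_funB => //.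
  by apply: measurable_funD; exact: measurable_funX.
have phiM p : E p -> `|phi p| <= d ^+ 2.
  rewrite /E /disc /= => pd; have n0 : 0 <= (p.1 - c.1) ^+ 2 + (p.2 - c.2) ^+ 2.
    by rewrite addr_ge0 ?sqr_ge0.
  by rewrite /phi ger0_norm; have := sqr_ge0 d; lra.
have mx := measurable_at_ray s01 cfx.
have my := measurable_at_ray s01 cfy.
have mxx : measurable_fun (E : set (mR * mR)) (fun p => fxx (ray c p s) * s).
  by apply: measurable_funM => //; exact: measurable_at_ray cfxx.
have myy : measurable_fun (E : set (mR * mR)) (fun p => fyy (ray c p s) * s).
  by apply: measurable_funM => //; exact: measurable_at_ray cfyy.
rewrite /radial RintegralD//; last 2 first.
- apply: (bounded_integrable mE Efin (measurable_funM mx mc1) (M := Mx * d)).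
  move=> p pE; rewrite normrM ler_pM//; last by case: (leD p pE).
  by apply: HMx => //; exact: disc_sub_closed.
- apply: (bounded_integrable mE Efin (measurable_funM my mc2) (M := My * d)).
  move=> p pE; rewrite normrM ler_pM//; last by case: (leD p pE).
  by apply: HMy => //; exact: disc_sub_closed.
have dl (k x : R) : is_derive x 1 (fun t : R => k + s * (t - k)) s.
  by apply: is_derive_eq; rewrite /GRing.scale/=; ring.
have cl (k x : R) : {for x, continuous (fun t : R => k + s * (t - k))}.
  exact: is_derive1_continuous (dl k x).
(* The integration by parts takes one bound for a function and its derivative, hence the sum of the
   two. *)
have gx p : E p -> `|fx (ray c p s)| <= Mx + Mxx.
  move=> pE; apply: (@le_trans _ _ Mx); last by rewrite lerDl (M0 fxx).
  by apply: HMx => //; exact: disc_sub_closed.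
have gxx p : E p -> `|fxx (ray c p s) * s| <= Mx + Mxx.
  move=> pE; apply: (@le_trans _ _ Mxx); last by rewrite lerDr (M0 fx).
  exact: sM.
have dx p : closed_disc c d p ->
    is_derive p.1 1 (fun t => fx (ray c (t, p.2) s)) (fxx (ray c p s) * s).
  move=> pd; have dp := is_derive_partial1 (dfxx (rayD s01 pd)).
  exact: (@is_derive1_comp R (fun t => fx (t, c.2 + s * (p.2 - c.2)))
    (fun t => c.1 + s * (t - c.1)) p.1 _ _ dp (dl _ _)).
have cx p : closed_disc c d p -> {for p.1, continuous (fun t => fxx (ray c (t, p.2) s) * s)}.
  move=> pd; apply: continuousM; last exact: cst_continuous.
  apply: (@continuous_comp _ _ _ (fun t : R => ray c (t, p.2) s) fxx).
    by apply: continuous_pair; [exact: cl|exact: cst_continuous].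
  by apply: cfxx; exact: (rayD s01 pd).
rewrite (ibp_disc1 d0 mx mxx gx gxx dx cx).
have gy p : E p -> `|fy (ray c p s)| <= My + Myy.
  move=> pE; apply: (@le_trans _ _ My); last by rewrite lerDl (M0 fyy).
  by apply: HMy => //; exact: disc_sub_closed.
have gyy p : E p -> `|fyy (ray c p s) * s| <= My + Myy.
  move=> pE; apply: (@le_trans _ _ Myy); last by rewrite lerDr (M0 fy).
  exact: sM.
have dy p : closed_disc c d p ->
    is_derive p.2 1 (fun t => fy (ray c (p.1, t) s)) (fyy (ray c p s) * s).
  move=> pd; have dp := is_derive_partial2 (dfyy (rayD s01 pd)).
  exact: (@is_derive1_comp R (fun t => fy (c.1 + s * (p.1 - c.1), t))
    (fun t => c.2 + s * (t - c.2)) p.2 _ _ dp (dl _ _)).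
have cy p : closed_disc c d p -> {for p.2, continuous (fun t => fyy (ray c (p.1, t) s) * s)}.
  move=> pd; apply: continuousM; last exact: cst_continuous.
  apply: (@continuous_comp _ _ _ (fun t : R => ray c (p.1, t) s) fyy).
    by apply: continuous_pair; [exact: cst_continuous|exact: cl].
  by apply: cfyy; exact: (rayD s01 pd).
rewrite (ibp_disc2 d0 my myy gy gyy dy cy).
rewrite -RintegralD//; last 2 first.
- apply: (bounded_integrable mE Efin (measurable_funM mxx mphi) (M := Mxx * d ^+ 2)).
  by move=> p pE; rewrite normrM ler_pM// ?phiM// sM.
- apply: (bounded_integrable mE Efin (measurable_funM myy mphi) (M := Myy * d ^+ 2)).
  by move=> p pE; rewrite normrM ler_pM// ?phiM// sM.
rewrite (@eq_Rintegral _ _ _ _ _ (fun=> 0)).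
  by rewrite Rintegral_cst// mul0r.
move=> p /set_mem pE; rewrite -mulrDl -mulrDl.
have [_ /(_ (ray c p s))] := hf.
by rewrite -/fx -/fy -/fxx -/fyy => ->; [rewrite !mul0r|apply: rayD => //; exact: disc_sub_closed].
Qed.

Lemma harmonic_disc_mean :
  \int[m2]_(p in E) f p = pi * d ^+ 2 * f c.
Proof.
have [Mx HMx] := bounded_along_ray cfx.
have [My HMy] := bounded_along_ray cfy.
have [Mf HMf] := bounded_along_ray cf.
have raycE p : f c = f (ray c p 0) by rewrite /ray !mul0r !addr0 -surjective_pairing.
have raypE p : f p = f (ray c p 1).
  by case: p => x y; rewrite /ray /=; congr (f (_, _)); ring.
have I01 s : I s -> 0 <= s <= 1 by rewrite /I /= in_itv.
have comp (g : R * R -> R) p (s : R) : (forall p, D p -> {for p, continuous g}) ->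
    closed_disc c d p -> 0 <= s <= 1 -> {for s, continuous (fun s => g (ray c p s))}.
  move=> cg pd s01; apply: continuous_comp; first exact: continuous_ray.
  by apply: cg; exact: rayD.
have nearD (P : R * R -> Prop) p : (forall q, D q -> P q) -> D p -> \forall q \near p, P q.
  move=> DP Dp; apply: (@filterS _ (nbhs p) _ D) => //.
  exact: open_nbhs_nbhs (conj open_unit_disc Dp).
have ftc p : E p -> \int[m1]_(s in I) radial p s = f p - f c.
  move=> /disc_sub_closed pd.
  have dr (s : R) : 0 <= s <= 1 -> is_derive s 1 (fun s => f (ray c p s)) (radial p s).
    move=> s01; have Dr := rayD s01 pd.
    apply: is_derive_line; last exact: cfx.
      exact: (nearD (fun q => derivable f q (dirx R)) _ dfx Dr).
    exact: (nearD (fun q => derivable f q (diry R)) _ dfy Dr).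
  have s0 : 0 <= (0 : R) <= 1 by rewrite lexx ler01.
  have s1 : 0 <= (1 : R) <= 1 by rewrite lexx ler01.
  rewrite /Rintegral (@continuous_FTC2 R (radial p) (fun s => f (ray c p s)) 0 1)//.
  - by rewrite -EFinB /= -raypE -raycE.
  - apply: continuous_in_subspaceT => s /set_mem /I01 s01.
    have ct (g : R * R -> R) (k : R) : (forall p, D p -> {for p, continuous g}) ->
        {for s, continuous (fun s => g (ray c p s) * k)}.
      by move=> cg; apply: continuousM; [exact: comp|exact: cst_continuous].
    exact: (continuousD (ct fx (p.1 - c.1) cfx) (ct fy (p.2 - c.2) cfy)).
  - split.
    + by move=> s; rewrite in_itv/= => /andP[h0 h1]; have [|//] := dr s; rewrite !ltW.
    + by apply: cvg_at_right_filter; exact: comp.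
    + by apply: cvg_at_left_filter; exact: comp.
  - move=> s; rewrite in_itv/= => /andP[h0 h1].
    have dsr : is_derive s 1 (fun s => f (ray c p s)) (radial p s) by apply: dr; rewrite !ltW.
    by rewrite derive1E derive_val.
have mfE : measurable_fun (E : set (mR * mR)) f.
  apply: measurable_funS (continuous_disc_measurable cf); first exact: measurable_unit_disc.
  by move=> p /disc_sub_closed/cD.
have fi : m2.-integrable E (EFin \o f).
  apply: (bounded_integrable mE Efin mfE (M := Mf)) => p /disc_sub_closed pd.
  by rewrite raypE HMf// lexx ler01.
have ci : m2.-integrable E (EFin \o cst (f c)).
  exact: (bounded_integrable mE Efin (M := `|f c|)).
have : \int[m2]_(p in E) (f p - f c) = 0.
  transitivity (\int[m2]_(p in E) \int[m1]_(s in I) radial p s).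
    by apply: eq_Rintegral => p /set_mem/ftc.
  transitivity (\int[m1]_(s in I) \int[m2]_(p in E) radial p s).
    have mr : measurable_fun (E `*` I) (fun z : (mR * mR) * mR => radial z.1 z.2).
      have m11 : measurable_fun (E `*` I) (fun z : (mR * mR) * mR => z.1.1 - c.1 : mR).
        by apply: measurable_funTS; apply: measurable_funB => //; exact: measurableT_comp.
      have m12 : measurable_fun (E `*` I) (fun z : (mR * mR) * mR => z.1.2 - c.2 : mR).
        by apply: measurable_funTS; apply: measurable_funB => //; exact: measurableT_comp.
      exact: (measurable_funD (measurable_funM (measurable_along_ray cfx) m11)
        (measurable_funM (measurable_along_ray cfy) m12)).
    have rM z : (E `*` I) z -> `|radial z.1 z.2| <= Mx * d + My * d.
      case: z => p s [/= /disc_sub_closed pd /I01 s01].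
      have [h1 h2] := closed_disc_le (ltW d0) pd.
      rewrite (le_trans (ler_normD _ _))// lerD// normrM ler_pM//; [exact: HMx|exact: HMy].
    exact: (@Rintegral_fubini _ _ _ _ R plane_lebesgue m1 E I
      (fun z => radial z.1 z.2) _ mE mI Efin Ifin mr rM).
  rewrite (@eq_Rintegral _ _ _ _ _ (fun=> 0)).
    by rewrite Rintegral_cst// mul0r.
  by move=> s /set_mem; rewrite /I /= in_itv; exact: radial_flux0.
rewrite RintegralB// Rintegral_cst//= area_disc//= => /eqP.
by rewrite subr_eq0 mulrC => /eqP.
Qed.

End harmonic.

(** * Growth of harmonic functions and conclusion *)

Lemma closed_disc_sub_unit_disc (r t d : R) : 0 <= r -> 0 < d -> d < 1 - r ->
  closed_disc (polar r t) d `<=` D.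
Proof.
move=> r0 d0 dr -[x y]; rewrite /closed_disc /unit_disc /polar /=.
have cs := cos2Dsin2 t; move: (cos t) (sin t) cs => C S cs H.
set h := x - r * C in H *; set k := y - r * S in H *.
have -> : x = r * C + h by rewrite /h; ring.
have -> : y = r * S + k by rewrite /k; ring.
have -> : (r * C + h) ^+ 2 + (r * S + k) ^+ 2 =
    r ^+ 2 * (C ^+ 2 + S ^+ 2) + 2 * r * (C * h + S * k) + (h ^+ 2 + k ^+ 2) by ring.
rewrite cs mulr1.
(* Cauchy-Schwarz against the unit vector [(C, S)], from the identity h^2 + k^2 - (C h + S k)^2 = (C
   k - S h)^2. *)
have hk : C * h + S * k <= d.
  apply: le_trans (ler_norm _) _; rewrite -ler_sqr ?nnegrE ?(ltW d0)// real_normK ?num_real//.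
  apply: le_trans H; rewrite -subr_ge0.
  have -> : h ^+ 2 + k ^+ 2 - (C * h + S * k) ^+ 2 =
    (h ^+ 2 + k ^+ 2) * (1 - (C ^+ 2 + S ^+ 2)) + (C * k - S * h) ^+ 2 by ring.
  by rewrite cs subrr mulr0 add0r sqr_ge0.
apply: (@le_lt_trans _ _ ((r + d) ^+ 2)).
  have hk2 : 2 * r * (C * h + S * k) <= 2 * r * d by rewrite ler_wpM2l// mulr_ge0.
  have -> : (r + d) ^+ 2 = r ^+ 2 + 2 * r * d + d ^+ 2 by ring.
  by rewrite lerD// lerD2l.
by rewrite expr_lt1 ?addr_ge0 ?(ltW d0)//; lra.
Qed.

Section a1R.
Variable u : R * R -> R[i].
Hypothesis ua : a1R R u.

Let uL : L1_disc R u. Proof. by case: ua. Qed.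
Let hu : harmonic_disc (fun p => complex.Re (u p)). Proof. by case: ua. Qed.

Lemma a1R_area_mean (r t d : R) : 0 <= r -> 0 < d -> d < 1 - r ->
  \int[mu]_(p in disc (polar r t) d) complex.Re (u p) = d ^+ 2 * complex.Re (u (polar r t)).
Proof.
move=> r0 d0 dr.
have sub := closed_disc_sub_unit_disc (t := t) r0 d0 dr.
have mE : measurable (disc (polar r t) d : set (mR * mR)) by exact: measurable_disc.
have Efin : (m2 (disc (polar r t) d) < +oo)%E by rewrite area_disc// ltry.
have [M HM] := continuous_closed_disc_bounded (ltW d0)
  (fun p pd => (hu.1 p (sub p pd)).1).
rewrite Rintegral_area//.
  rewrite (harmonic_disc_mean d0 sub hu) !mulrA mulVf ?mul1r//.
  by rewrite gt_eqF// pi_gt0.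
apply: (bounded_integrable mE Efin (M := M)).
  apply: measurable_funS (measurable_Re uL); first exact: measurable_unit_disc.
  by move=> p /disc_sub_closed/sub.
by move=> p /disc_sub_closed/HM.
Qed.

(** The disc of radius d about the point has normalized area d^2, so the mean value property gives
    d^2 |u| <= L. The closed disc must stay inside the unit disc, so this holds for d < 1 - r only,
    and the bound is its limit as d tends to 1 - r. *)
Lemma a1R_growth (r t : R) : 0 <= r < 1 ->
  ((normc (u (polar r t)))%:E <= ((1 - r) ^- 2)%:E * L1norm u)%E.
Proof.
move=> /andP[r0 r1]; have LE := L1norm_fin uL; set L := fine (L1norm u) in LE.
have L0 : 0 <= L by rewrite fine_ge0// L1norm_ge0.
have pD : D (polar r t) by rewrite unit_discE; exact/disc0_polar.
have -> : normc (u (polar r t)) = `|complex.Re (u (polar r t))|.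
  case: ua => _ /(_ _ pD) + _; case: (u _) => x y /= ->.
  by rewrite expr0n /= addr0 sqrtr_sqr.
set k := `|_|.
have key d : 0 < d -> d < 1 - r -> d ^+ 2 * k <= L.
  move=> d0 dr; have sub := closed_disc_sub_unit_disc (t := t) r0 d0 dr.
  have mE : measurable (disc (polar r t) d : set (mR * mR)) by exact: measurable_disc.
  have mD := @measurable_unit_disc.
  have ED : disc (polar r t) d `<=` D by move=> p /disc_sub_closed/sub.
  have iRe := integrableS mD mE ED uL.1.
  have ui := integrable_normc uL.
  rewrite -[d ^+ 2]ger0_norm ?sqr_ge0// -normrM -a1R_area_mean//.
  apply: le_trans (le_normr_Rintegral mE iRe) _.
  apply: (@le_trans _ _ (\int[mu]_(p in disc (polar r t) d) normc (u p))).
    apply: le_Rintegral => //.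
    - exact: (integrable_norm (f := fun p : mR * mR => complex.Re (u p)) iRe).
    - exact: integrableS mD mE ED ui.
    - by move=> p _; exact: normr_Re_le_normc.
  rewrite /Rintegral /L; apply: fine_le.
  - exact: (integrable_fin_num mE (integrableS mD mE ED ui)).
  - by rewrite LE.
  - apply: ge0_subset_integral => //.
      exact: measurable_int ui.
    by move=> p _; rewrite lee_fin normc_ge0.
have s0 : 0 < 1 - r by lra.
rewrite LE -EFinM lee_fin mulrC ler_pdivlMr ?exprn_gt0// mulrC.
rewrite leNgt; apply/negP => kL.
have k0 : 0 < k.
  by rewrite lt_def normr_ge0 andbT; apply/eqP => k0; move: kL; rewrite k0 mulr0 ltNge L0.
have sq : Num.sqrt (L / k) < 1 - r.
  rewrite -(gtr0_norm s0) -sqrtr_sqr ltr_sqrt ?exprn_gt0//.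
  by rewrite ltr_pdivrMr.
have sq0 := sqrtr_ge0 (L / k).
have sq2 : Num.sqrt (L / k) ^+ 2 = L / k by rewrite sqr_sqrtr// divr_ge0// ltW.
(* The limit is taken by contradiction: if (1 - r)^2 k > L, then sqrt(L / k) < 1 - r, and any [d]
   strictly between them violates [key]. *)
pose d := (Num.sqrt (L / k) + (1 - r)) / 2.
have dsq : Num.sqrt (L / k) < d by rewrite /d; lra.
have := key d (le_lt_trans sq0 dsq) ltac:(rewrite /d; lra).
by rewrite leNgt -ltr_pdivrMr// -sq2 ltr_sqr ?nnegrE// ?dsq// (le_trans sq0)// ltW.
Qed.

Lemma a1R_L1norm_Bop_le : (L1norm (Bop u) <= (1835 / 1000 : R)%:E * L1norm u)%E.
Proof.
apply: L1norm_Bop_le => // [r t|rho /andP[rho0 rho1]]; first exact: a1R_growth.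
have polar0 : polar 0 0 = (0, 0) :> R * R by rewrite /polar !mul0r.
split; first by rewrite -polar0 a1R_area_mean ?subr0.
have Im0 p : D p -> complex.Im (u p) = 0 by case: ua => _ + _; exact.
rewrite Im0; last by rewrite -polar0 unit_discE; apply/disc0_polar.
rewrite mulr0 (@eq_Rintegral _ _ _ _ _ (fun=> 0)).
  by rewrite Rintegral_cst ?mul0r//; exact: measurable_disc.
move=> p /set_mem pE; apply: Im0; apply: disc_sub_unit_disc pE.
by rewrite rho0 ltW.
Qed.

End a1R.

End plane.

Theorem theorem3p4 (R : realType) :
  (opnorm (a1R R) (@Bop R) <= (1835 / 1000 : R)%:E)%E /\
  (forall X : set (R * R -> R[i]),
     X `<=` L1_disc R ->
     real_subspace X ->
     (forall u, X u -> forall r t : R, 0 <= r < 1 ->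
        ((normc (u (polar r t)))%:E <= ((1 - r) ^- 2)%:E * L1norm u)%E) ->
     (forall u, X u -> forall r s : R, 0 <= r < 1 -> 0 <= s < 1 ->
        circle_mean u r = circle_mean u s) ->
     forall u, X u -> (L1norm (Bop u) <= (1835 / 1000 : R)%:E * L1norm u)%E).
Proof.
split=> [|X XL _ Xb Xm u Xu].
  apply: ge_ereal_sup => _ [u [ua u1] <-].
  apply: le_trans (a1R_L1norm_Bop_le ua) _.
  have c0 : (0 <= (1835 / 1000 : R)%:E)%E by rewrite lee_fin divr_ge0 ?ler0n.
  have := lee_wpmul2l c0 u1; rewrite mule1; exact.
by apply: circle_mean_L1norm_Bop_le; [exact: XL|exact: Xb|exact: Xm].
Qed.
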